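(* Up to a product of circles, every moment-angle complex arising from a rationally starshaped sphere can be endowed with a complex structure of LVMB manifold. Precisely: let $K$ be a rationally starshaped sphere with $v$ vertices, with vertex set $\{1,\dots,v\}$. Then there exists an integer $q\ge 0$ such that $\mathcal Z_{K,v}\times (S^1)^q=\mathcal Z_{K,v+q}$ is homeomorphic to an LVMB manifold (and so can be endowed with a complex structure as an LVMB manifold).
   Context: Moment-angle complexes. Let $\mathbb D$ be the closed unit disk in $\mathbb C$ and $K$ a simplicial complex on $\{1,\dots,N\}$ (elements of $\{1,\dots,N\}$ that are not vertices of $K$ are allowed). For $\sigma\subset\{1,\dots,N\}$ put $B_\sigma=\{z\in\mathbb D^N: |z_j|=1\ \forall j\notin\sigma\}$. The moment-angle complex associated to $K$ is $\mathcal Z_{K,N}=\bigcup_{\sigma\in K}B_\sigma$. If $K$ is a complex on $\{1,\dots,v\}$, it may be regarded as a complex on $\{1,\dots,v+q\}$, and $\mathcal Z_{K,v+q}=\mathcal Z_{K,v}\times(S^1)^q$. LVMB manifolds. Let $m\ge 0$ and $n\ge 2m+1$ be integers. A fundamental set of type $(2m+1,n)$ is a nonempty set $\mathcal E$ of subsets of $\{1,\dots,n\}$, all of cardinality $2m+1$. A subset of $\{1,\dots,n\}$ is acceptable if it contains an element of $\mathcal E$; $\mathcal A$ denotes the set of acceptable subsets. For $z\in\mathbb C^n$ put $I_z=\{k: z_k\ne 0\}$ and $\mathcal S=\{z\in\mathbb C^n: I_z\in\mathcal A\}$. Let $\langle z,w\rangle=\sum_j z_jw_j$ (non-hermitian).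 Let $l=(l_1,\dots,l_n)$ be a family in $\mathbb C^m\cong\mathbb R^{2m}$. The pair $(\mathcal E,l)$ is an acceptable system if for every $Q\in\mathcal E$ the family $(l_q)_{q\in Q}$ affinely spans $\mathbb C^m$ as a real affine space. Then $\mathbb C^*\times\mathbb C^m$ acts freely on $\mathcal S$ by $(\alpha,T)\cdot z=(\alpha e^{\langle l_1,T\rangle}z_1,\dots,\alpha e^{\langle l_n,T\rangle}z_n)$; let $\mathcal N$ be the orbit space. $(\mathcal E,l)$ is a good system if it is an acceptable system and $\mathcal N$ can be endowed with a structure of compact complex manifold such that the projection $\mathcal S\to\mathcal N$ is holomorphic; $\mathcal N$ is then called an LVMB manifold. Rationally starshaped spheres. A simplicial $d$-sphere is an abstract simplicial complex whose geometric realization is homeomorphic to the sphere $S^d$. A $d$-sphere $K$ is rationally starshaped if there exist a lattice $L$ in $\mathbb R^{d+1}$, a point $p_0\in L$ and a realization $|K|$ of $K$ in $\mathbb R^{d+1}$ (a geometric simplicial complex with straight simplices, combinatorially isomorphic to $K$) such that every vertex of $|K|$ belongs to $L$ and every ray emanating from $p_0$ intersects $|K|$ in exactly one point. *)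

(* Defs.v *)
From HB Require Import structures.
From mathcomp Require Export all_boot all_order all_algebra.
From mathcomp Require Export all_classical all_reals all_analysis.
From mathcomp Require Export complex.
Set Implicit Arguments.
Unset Strict Implicit.
Unset Printing Implicit Defensive.
From mathcomp Require Import generic_quotient ring.
Import Order.TTheory GRing.Theory Num.Theory.
Import numFieldNormedType.Exports.
Local Open Scope classical_set_scope.
Local Open Scope ring_scope.

(* R[i] packaged as a numClosedFieldType, so that it inherits the norm topology
   and the structure of normed module over itself. *)
Definition CC (R : realType) : numClosedFieldType := R[i].

Section Homeomorphisms.

Definition homeomorphism (T U : topologicalType) (h : T -> U) : Prop :=
  exists g : U -> T, [/\ continuous h, continuous g, cancel h g & cancel g h].

Definition homeomorphic (T U : topologicalType) : Prop :=
  exists h : T -> U, homeomorphism h.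

End Homeomorphisms.

Section SimplicialComplexes.

Definition simplicial_complex (v : nat) (K : {set {set 'I_v}}) : Prop :=
  finset.set0 \in K /\
  forall s t : {set 'I_v}, s \in K -> t \subset s -> t \in K.

Definition has_full_vertex_set (v : nat) (K : {set {set 'I_v}}) : Prop :=
  forall i : 'I_v, [set i]%SET \in K.

(* K regarded as a complex on a ground set with q additional elements, none of
   which is a vertex. *)
Definition extend_complex (v q : nat) (K : {set {set 'I_v}}) :
    {set {set 'I_(v + q)}} :=
  [set lshift q @: s | s : {set 'I_v} in K]%SET.

Variable R : realType.

(* The convex hull of the points x_i, i \in s. *)
Definition simplex_hull (v k : nat) (x : 'I_v -> 'rV[R]_k) (s : {set 'I_v}) :
    set 'rV[R]_k :=
  [set y | exists t : 'I_v -> R,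
     [/\ forall i, 0 <= t i,
         forall i, i \notin s -> t i = 0,
         \sum_i t i = 1
       & y = \sum_i t i *: x i]].

Definition polyhedron (v k : nat) (x : 'I_v -> 'rV[R]_k)
    (K : {set {set 'I_v}}) : set 'rV[R]_k :=
  \bigcup_(s in [set` K]) simplex_hull x s.

(* The geometric realization of an abstract complex: the i-th vertex is placed
   at the i-th vector of the standard basis. *)
Definition geometric_realization (v : nat) (K : {set {set 'I_v}}) :
    set 'rV[R]_v :=
  polyhedron (fun i : 'I_v => delta_mx ord0 i) K.

Definition unit_sphere (d : nat) : set 'rV[R]_d.+1 :=
  [set x | \sum_i x ord0 i ^+ 2 = 1].
Arguments unit_sphere : clear implicits.

Definition simplicial_sphere (d v : nat) (K : {set {set 'I_v}}) : Prop :=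
  simplicial_complex K /\
  homeomorphic (set_type (geometric_realization K)) (set_type (unit_sphere d)).

Definition affinely_independent (v k : nat) (x : 'I_v -> 'rV[R]_k)
    (s : {set 'I_v}) : Prop :=
  forall t : 'I_v -> R, (forall i, i \notin s -> t i = 0) ->
    \sum_i t i = 0 -> \sum_i t i *: x i = 0 -> forall i, t i = 0.

(* The straight simplices simplex_hull x s, s \in K, form a geometric simplicial
   complex, for which i |-> x i is an isomorphism from K. *)
Definition straight_realization (v k : nat) (x : 'I_v -> 'rV[R]_k)
    (K : {set {set 'I_v}}) : Prop :=
  (forall s, s \in K -> affinely_independent x s) /\
  (forall s t, s \in K -> t \in K ->
     simplex_hull x s `&` simplex_hull x t = simplex_hull x (s :&: t)).

Definition is_lattice (k : nat) (L : set 'rV[R]_k) : Prop :=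
  exists2 B : 'M[R]_k, B \in unitmx &
    L = [set map_mx intr z *m B | z in [set: 'rV[int]_k]].

Definition ray (k : nat) (p u : 'rV[R]_k) : set 'rV[R]_k :=
  [set p + t *: u | t in [set t : R | 0 <= t]].

Definition rationally_starshaped_sphere (d v : nat) (K : {set {set 'I_v}}) :
    Prop :=
  simplicial_sphere d K /\
  exists (L : set 'rV[R]_d.+1) (p0 : 'rV[R]_d.+1) (x : 'I_v -> 'rV[R]_d.+1),
    [/\ is_lattice L,
        L p0,
        straight_realization x K,
        forall i, [set i]%SET \in K -> L (x i)
      & forall u : 'rV[R]_d.+1, u != 0 ->
          exists! y, (ray p0 u `&` polyhedron x K) y].

End SimplicialComplexes.
Arguments rationally_starshaped_sphere R d {v} K.

Section MomentAngleComplexes.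
Variable R : realType.

Definition polydisk_block (N : nat) (s : {set 'I_N}) : set 'rV[CC R]_N :=
  [set z | (forall j, `|z ord0 j| <= 1) /\
           (forall j, j \notin s -> `|z ord0 j| = 1)].

Definition moment_angle (N : nat) (K : {set {set 'I_N}}) : set 'rV[CC R]_N :=
  \bigcup_(s in [set` K]) polydisk_block s.

Definition torus (q : nat) : set 'rV[CC R]_q :=
  [set w | forall j, `|w ord0 j| = 1].

End MomentAngleComplexes.
Arguments moment_angle R {N} K.
Arguments torus : clear implicits.

Section ComplexManifolds.
Variable R : realType.

(* Differentiability is over the field CC R. *)
Definition holomorphic_on (a b : nat) (U : set 'rV[CC R]_a)
    (f : 'rV[CC R]_a -> 'rV[CC R]_b) : Prop :=
  forall x, U x -> differentiable f x.

(* chart_map and chart_inv are total functions, of which only the restrictions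
   to chart_dom and to its image are meaningful. *)
Record chart (T : topologicalType) (k : nat) := Chart {
  chart_dom : set T;
  chart_map : T -> 'rV[CC R]_k;
  chart_inv : 'rV[CC R]_k -> T }.

Definition is_chart (T : topologicalType) (k : nat) (c : chart T k) : Prop :=
  [/\ open (chart_dom c),
      open (chart_map c @` chart_dom c),
      {within chart_dom c, continuous (chart_map c)},
      {within chart_map c @` chart_dom c, continuous (chart_inv c)}
    & forall x, chart_dom c x -> chart_inv c (chart_map c x) = x].

Definition complex_atlas (T : topologicalType) (k : nat) (A : set (chart T k)) :
    Prop :=
  [/\ forall c, A c -> is_chart c,
      forall x, exists2 c, A c & chart_dom c x
    & forall c c', A c -> A c' ->
        holomorphic_on (chart_map c @` (chart_dom c `&` chart_dom c'))
                       (chart_map c' \o chart_inv c)].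

Definition compact_complex_manifold (T : topologicalType) (k : nat)
    (A : set (chart T k)) : Prop :=
  [/\ hausdorff_space T, @second_countable T, compact [set: T]
    & complex_atlas A].

Definition holomorphic_map (T U : topologicalType) (k k' : nat)
    (A : set (chart T k)) (A' : set (chart U k')) (f : T -> U) : Prop :=
  continuous f /\
  forall c c', A c -> A' c' ->
    holomorphic_on (chart_map c @` (chart_dom c `&` f @^-1` chart_dom c'))
                   (chart_map c' \o f \o chart_inv c).

Definition biholomorphic (T U : topologicalType) (k k' : nat)
    (A : set (chart T k)) (A' : set (chart U k')) : Prop :=
  exists (f : T -> U) (g : U -> T),
    [/\ cancel f g, cancel g f,
        holomorphic_map A A' f & holomorphic_map A' A g].

(* Holomorphy of a map defined on an open subset S of C^n. Composed with a
   chart, the map is extended by 0 outside S; as S is open, this does not affect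
   differentiability at the points of S. *)
Definition holomorphic_from_open (n : nat) (S : set 'rV[CC R]_n)
    (T : topologicalType) (k : nat) (A : set (chart T k))
    (f : set_type S -> T) : Prop :=
  [/\ open S, continuous f
    & forall c, A c -> forall z : set_type S, chart_dom c (f z) ->
        differentiable (valL_ (0 : 'rV[CC R]_k) (chart_map c \o f)) (val z)].

End ComplexManifolds.

Section LVMB.
Variable R : realType.

Definition cexp (z : CC R) : CC R :=
  Complex (expR (complex.Re z) * cos (complex.Im z))
          (expR (complex.Re z) * sin (complex.Im z)).

Lemma cexp0 : cexp 0 = 1.
Proof. by rewrite /cexp /= expR0 cos0 sin0 mulr1 mulr0. Qed.

Lemma cexpD (z w : CC R) : cexp (z + w) = cexp z * cexp w.
Proof.
case: z => a b; case: w => c e; rewrite /cexp /= expRD cosD sinD.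
by apply/eqP; rewrite eq_complex /=; apply/andP; split; apply/eqP; ring.
Qed.

Definition bilinear_form (m : nat) (z w : 'rV[CC R]_m) : CC R :=
  \sum_j z ord0 j * w ord0 j.

Section Systems.
Variables (m n : nat) (E : {set {set 'I_n}}) (l : 'I_n -> 'rV[CC R]_m).

Definition fundamental_set : Prop :=
  [/\ ((2 * m).+1 <= n)%N, E != finset.set0 &
      forall Q : {set 'I_n}, Q \in E -> #|Q| = (2 * m).+1].

Definition acceptable (P : {set 'I_n}) : Prop :=
  exists2 Q : {set 'I_n}, Q \in E & Q \subset P.

Definition coord_support (z : 'rV[CC R]_n) : {set 'I_n} :=
  [set k | z ord0 k != 0]%SET.

Definition acceptable_points : set 'rV[CC R]_n :=
  [set z | acceptable (coord_support z)].

(* The affine combinations have real coefficients. *)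
Definition real_affinely_spans (Q : {set 'I_n}) : Prop :=
  forall y : 'rV[CC R]_m, exists t : 'I_n -> R,
    \sum_(i in Q) t i = 1 /\ y = \sum_(i in Q) (t i)%:C%C *: l i.

Definition acceptable_system : Prop :=
  fundamental_set /\ forall Q, Q \in E -> real_affinely_spans Q.

Definition lvmb_act (a : CC R) (T : 'rV[CC R]_m) (z : 'rV[CC R]_n) :
    'rV[CC R]_n :=
  \row_j (a * cexp (bilinear_form (l j) T) * z ord0 j).

Definition same_orbit (z w : set_type acceptable_points) : bool :=
  `[< exists (a : CC R) (T : 'rV[CC R]_m),
        a != 0 /\ val w = lvmb_act a T (val z) >].

Lemma lvmb_act1 z : lvmb_act 1 0 z = z.
Proof.
apply/rowP => j; rewrite mxE /bilinear_form big1 ?cexp0 ?mul1r// => i _.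
by rewrite mxE mulr0.
Qed.

Lemma lvmb_actM a b T U z :
  lvmb_act a T (lvmb_act b U z) = lvmb_act (a * b) (T + U) z.
Proof.
apply/rowP => j; rewrite !mxE.
have -> : bilinear_form (l j) (T + U) =
          bilinear_form (l j) T + bilinear_form (l j) U.
  by rewrite /bilinear_form -big_split; apply: eq_bigr => i _; rewrite mxE mulrDr.
by rewrite cexpD; ring.
Qed.

Lemma same_orbit_refl : reflexive same_orbit.
Proof.
by move=> z; apply/asboolP; exists 1, 0; rewrite lvmb_act1 oner_neq0.
Qed.

Lemma same_orbit_sym : symmetric same_orbit.
Proof.
suff H z w : same_orbit z w -> same_orbit w z.
  by move=> z w; apply/idP/idP; apply: H.
move=> /asboolP[a [T [a0 e]]]; apply/asboolP; exists a^-1, (- T).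
by rewrite invr_eq0 e lvmb_actM mulVf// addNr lvmb_act1.
Qed.

Lemma same_orbit_trans : transitive same_orbit.
Proof.
move=> w z u /asboolP[a [T [a0 e]]] /asboolP[b [U [b0 e']]].
apply/asboolP; exists (b * a), (U + T).
by rewrite mulf_neq0// e' e lvmb_actM.
Qed.

Definition orbit_equiv : equiv_rel (set_type acceptable_points) :=
  EquivRel same_orbit same_orbit_refl same_orbit_sym same_orbit_trans.

Definition orbit_space : topologicalType :=
  quotient_topology {eq_quot orbit_equiv}%qT.

Definition orbit_proj (z : set_type acceptable_points) : orbit_space :=
  (\pi_{eq_quot orbit_equiv} z)%qT.

Definition lvmb_structure (k : nat) (A : set (chart R orbit_space k)) : Prop :=
  compact_complex_manifold A /\ holomorphic_from_open A orbit_proj.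

Definition good_system : Prop :=
  acceptable_system /\
  exists (k : nat) (A : set (chart R orbit_space k)), lvmb_structure A.

End Systems.
End LVMB.

(* Main.v *)
Require Import Defs.
From mathcomp Require Import generic_quotient ring lra zify.
Set Implicit Arguments.
Unset Strict Implicit.
Unset Printing Implicit Defensive.
Import Order.TTheory GRing.Theory Num.Theory.
Import numFieldNormedType.Exports.
Local Open Scope classical_set_scope.
Local Open Scope ring_scope.

(** Write D = d + 1.  The vectors a_i from the center to the vertices of the
    starshaped sphere span a complete simplicial fan: every b in R^D is, in
    exactly one way, a combination of the a_i with nonnegative coefficients
    supported on a face of K ([starshaped_fan]).  Everything else is deduced from
    this property.

    Let m be the dimension v - D of the space of linear relations between the
    a_i and let B be an m x v matrix whose rows are a basis of it.  Adjoin m ghost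
    vertices, and one more coordinate to be normalized to 1 by the factor C^* of
    the group.  With l = 0 at the latter, l = e_a at the a-th ghost vertex and
    l = - i B_j at the vertex j, where B_j is the j-th column of B, a vector T
    multiplies the a-th ghost coordinate by exp(T_a) and the coordinate of the
    vertex j by exp(((Im T) B)_j) times a complex number of modulus 1.  The
    fundamental set consists of the complements of the facets of K; by Gale
    duality, the system is acceptable ([lvmb_acceptable]).

    Topology.  On the complement U of the coordinate subspace arrangement of K,
    the group R^m acts by the flow which multiplies x_j by exp((t B)_j).  Taking
    logarithms of moduli, the fan property says that each orbit of this flow meets
    the moment-angle complex in exactly one point, and the time needed to reach it
    is continuous ([flow_unique], [flow_exists_near]).  So each orbit of
    C^* x C^m in the set of acceptable points has a unique representative in the
    moment-angle complex of K with ghost vertices, which depends continuously on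
    the point.  This gives the homeomorphism, and with it that the orbit space is
    compact and Hausdorff.

    Complex structure.  Every orbit also meets the slice where the ghost
    coordinates and the normalized one are 1, which is a copy of U.  The vectors T
    that preserve the slice are those of 2 pi i Z^m, and they act on U by the flow
    at times in 2 pi Z^m: the orbit space is the quotient of U by a discrete group
    of diagonal linear maps.  The flow time is an equivariant map from U to R^m,
    hence the quotient map is injective on the small open sets where this time
    varies little; the inverses of its restrictions to such sets form the atlas,
    and the coordinate changes are locally linear ([slice_transition]).  The
    projection onto the orbit space is holomorphic because near a point the vector
    T that moves it into the slice is given by a branch of the logarithm
    ([slice_lift]). *)

(** * Limits of matrix-valued functions *)

Section MatrixLimits.

Lemma cvg_mx (X : Type) (F : set_system X) {FF : Filter F}
    (T : topologicalType) (m n : nat)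
    (f : X -> 'M[T]_(m, n)) (M : 'M[T]_(m, n)) :
  (forall i j, f x i j @[x --> F] --> M i j) -> f @ F --> M.
Proof.
move=> cf U [P PM PU].
have FP i j : F [set x | P i j (f x i j)] by apply: cf; exact: PM.
apply: (@filterS _ F _ _ _ _ (filter_forall FF (fun i => filter_forall FF (FP i)))).
by move=> x Px; exact: PU.
Qed.

Variable R : numFieldType.

Lemma cvg_coord (X : Type) (F : set_system X) {FF : Filter F} (m n : nat)
    (f : X -> 'M[R]_(m, n)) (M : 'M[R]_(m, n)) i j :
  f @ F --> M -> f x i j @[x --> F] --> M i j.
Proof.
move=> cf.
exact: (@cvg_comp _ _ _ f (fun N => N i j) _ _ _ cf (@coord_continuous R m n i j M)).
Qed.

Lemma cvg_sum_ord (X : Type) (F : set_system X) {FF : Filter F} (n : nat)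
    (f : 'I_n -> X -> R) (l : 'I_n -> R) :
  (forall i, f i @ F --> l i) -> \sum_i f i x @[x --> F] --> \sum_i l i.
Proof.
by move=> cf; apply: cvg_big => //; exact: add_continuous.
Qed.

Lemma mulmxr_cvg (X : Type) (F : set_system X) {FF : Filter F} (m n p : nat)
    (f : X -> 'M[R]_(m, n)) (M : 'M[R]_(m, n)) (A : 'M[R]_(n, p)) :
  f @ F --> M -> f x *m A @[x --> F] --> M *m A.
Proof.
move=> cf; apply: cvg_mx => i j.
rewrite mxE; under eq_fun do rewrite mxE.
by apply: cvg_sum_ord => k; apply: cvgMr_tmp; exact: cvg_coord.
Qed.

End MatrixLimits.

(** * Complete simplicial fans *)

Section CompleteFans.
Variables (R : realType) (v D : nat).
Implicit Types (A : 'M[R]_(v, D)) (K : {set {set 'I_v}}) (c : 'rV[R]_v).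

Definition csupp c : {set 'I_v} := [set i | c ord0 i != 0]%SET.

Definition cone_coords A K (b : 'rV[R]_D) c : Prop :=
  [/\ forall i, 0 <= c ord0 i, csupp c \in K & c *m A = b].

Definition complete_fan A K : Prop :=
  simplicial_complex K /\ forall b, exists! c, cone_coords A K b c.

(** The unique conical coordinates of b when (A, K) is a complete fan. *)
Definition fan_coord A K (b : 'rV[R]_D) : 'rV[R]_v :=
  xget 0 [set c | cone_coords A K b c].

Definition charv (s : {set 'I_v}) : 'rV[R]_v := \row_i (i \in s)%:R.

Lemma csuppP c (s : {set 'I_v}) :
  reflect (forall i, i \notin s -> c ord0 i = 0) (csupp c \subset s).
Proof.
apply: (iffP fintype.subsetP) => h i; last first.
  by rewrite inE; apply: contraNT => /h ->.
by move=> iNs; apply/eqP; apply: contraNT iNs => ci; apply: h; rewrite inE.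
Qed.

Variables (A : 'M[R]_(v, D)) (K : {set {set 'I_v}}).
Hypothesis fanAK : complete_fan A K.

Lemma fan_coordP b : cone_coords A K b (fan_coord A K b).
Proof.
have [_ /(_ b)[c [hc _]]] := fanAK.
by apply: (@xgetPex _ 0 [set c | cone_coords A K b c]); exists c.
Qed.

Lemma cone_coords_inj b c c' :
  cone_coords A K b c -> cone_coords A K b c' -> c = c'.
Proof. by have [_ /(_ b)[c0 [_ u]]] := fanAK => /u <- /u <-. Qed.

Lemma fan_coordE b c : cone_coords A K b c -> fan_coord A K b = c.
Proof. by move=> h; exact: cone_coords_inj (fan_coordP b) h. Qed.

Lemma face_sub (s t : {set 'I_v}) : s \in K -> t \subset s -> t \in K.
Proof. by have [[_ h] _] := fanAK; exact: h. Qed.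

Lemma face0 : finset.set0 \in K.
Proof. by have [[]] := fanAK. Qed.

(** The positive and the negative part of a relation supported on a face are two
    families of conical coordinates of the same vector. *)
Lemma face_independent (s : {set 'I_v}) c :
  s \in K -> csupp c \subset s -> c *m A = 0 -> c = 0.
Proof.
move=> sK /csuppP cs cA.
pose p : 'rV[R]_v := \row_i Num.max (c ord0 i) 0.
have pc i : (p - c) ord0 i = Num.max 0 (- c ord0 i).
  by rewrite !mxE; case: (lerP 0 (c ord0 i)) => h; case: (lerP 0 (- c ord0 i)) => h2; lra.
have hp : cone_coords A K (p *m A) p.
  split=> //; first by move=> i; rewrite mxE le_max lexx orbT.
  by apply: (face_sub sK); apply/csuppP => i /cs ci; rewrite mxE ci maxxx.
have hpc : cone_coords A K (p *m A) (p - c).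
  split; first by move=> i; rewrite pc le_max lexx.
    by apply: (face_sub sK); apply/csuppP => i /cs ci; rewrite pc ci oppr0 maxxx.
  by rewrite mulmxBl cA subr0.
have /eqP := cone_coords_inj hp hpc.
by rewrite eq_sym subr_eq addrC -subr_eq subrr => /eqP.
Qed.

(** On the coefficients supported on a face, [*m A] is injective and so has a linear
    left inverse.  It expresses [fan_coord] as a linear map on the cone of s. *)
Lemma face_left_inverse (s : {set 'I_v}) : s \in K ->
  exists P : 'M[R]_(D, v), forall c, csupp c \subset s -> c *m A *m P = c.
Proof.
move=> sK; pose S : 'M[R]_v := diag_mx (charv s).
have hS (c : 'rV[R]_v) : csupp c \subset s -> c *m S = c.
  move=> /csuppP cs; apply/rowP => i; rewrite mul_mx_diag !mxE.
  by case: (boolP (i \in s)) => [|/cs ->]; rewrite ?mulr1 ?mul0r.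
have suppS (c : 'rV[R]_v) : csupp (c *m S) \subset s.
  apply/csuppP => i iNs; rewrite mul_mx_diag !mxE (negbTE iNs) mulr0 //.
have : (S^T <= (S *m A)^T)%MS.
  rewrite submxE; apply/eqP/trmx_inj/row_matrixP => i.
  rewrite trmx_mul trmxK trmx0 row0 row_mul.
  apply: (@face_independent s) => //; rewrite -mulmxA -row_mul.
  set C := cokermx _; suff -> : C^T *m (S *m A) = 0 by rewrite row0.
  by apply: trmx_inj; rewrite trmx_mul trmxK mulmx_coker trmx0.
case/submxP=> P0 /(congr1 trmx); rewrite trmx_mul !trmxK => hP.
exists P0^T => c /hS <-.
by rewrite [in RHS]hP !mulmxA.
Qed.

(** The space is covered by finitely many closed cones, on each of which
    [fan_coord] is linear; only the cones that contain b matter near b. *)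
Lemma fan_coord_continuous : continuous (fan_coord A K).
Proof.
move=> b U Ub.
pose cone (s : {set 'I_v}) := [set b' | csupp (fan_coord A K b') \subset s].
suff near_cone (s : {set 'I_v}) : s \in K ->
    \forall b' \near b, cone s b' -> U (fan_coord A K b').
  have : \forall b' \near b, forall s : {set 'I_v},
      s \in K -> cone s b' -> U (fan_coord A K b').
    apply: (filter_forall (nbhs_filter b)) => s; have [sK|_] := boolP (s \in K).
      by apply: filterS (near_cone s sK) => b' h _.
    by near=> b'.
  apply: filterS => b' /(_ (csupp (fan_coord A K b'))); apply.
    by have [] := fan_coordP b'.
  exact: subxx.
move=> sK; have [P hP] := face_left_inverse sK.
have hcone b' : cone s b' <-> [/\ forall i, 0 <= (b' *m P) ord0 i,
     csupp (b' *m P) \subset s & b' *m P *m A = b'].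
  split=> [h|[h1 h2 h3]].
    have [p1 p2 p3] := fan_coordP b'.
    by have := hP _ h; rewrite p3 => ->.
  rewrite /cone /= (@fan_coordE _ (b' *m P)) //; split=> //; exact: face_sub h2.
have coneE b' : cone s b' -> fan_coord A K b' = b' *m P.
  by move=> h; have [_ _ {2}<-] := fan_coordP b'; rewrite hP.
have PC : (fun b' : 'rV[R]_D => b' *m P) @ b --> b *m P.
  by apply: (mulmxr_cvg (F := nbhs b)); exact: cvg_id.
have PCi i : (b' *m P) ord0 i @[b' --> b] --> (b *m P) ord0 i.
  exact: (cvg_coord (F := nbhs b)).
have [bs|bNs] := pselect (cone s b).
  have : \forall b' \near b, U (b' *m P) by apply: PC; rewrite -coneE.
  by apply: filterS => b' h bs'; rewrite coneE.
(* the cone is closed: the condition that fails at b still fails near b *)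
suff : \forall b' \near b, ~ cone s b' by apply: filterS.
have [[j hj]|h1] := pselect (exists i, (b *m P) ord0 i < 0).
  near=> b' => /hcone[/(_ j) + _ _].
  apply/negP; rewrite -ltNge; near: b'.
  exact: (cvgr_lt _ (PCi j)).
have [[j [jNs hj]]|h2] := pselect (exists i, i \notin s /\ (b *m P) ord0 i != 0).
  near=> b' => /hcone[_ /csuppP/(_ _ jNs)/eqP + _].
  apply/negP; near: b'; exact: (cvgr_neq0 _ (PCi j)).
have [[j hj]|h3] := pselect (exists j, (b *m P *m A) ord0 j != b ord0 j).
  have : (b' *m P *m A - b') ord0 j @[b' --> b] --> (b *m P *m A - b) ord0 j.
    apply: (cvg_coord (F := nbhs b)); apply: (cvgB (F := nbhs b)) => //.
    by apply: (mulmxr_cvg (F := nbhs b)).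
  move=> c; near=> b' => /hcone[_ _ e].
  suff : (b' *m P *m A - b') ord0 j != 0 by rewrite e subrr mxE eqxx.
  near: b'; apply: (cvgr_neq0 _ c); by rewrite !mxE subr_eq0; rewrite mxE in hj.
exfalso; apply: bNs; apply/hcone; split.
- by move=> i; rewrite leNgt; apply/negP => h; apply: h1; exists i.
- by apply/csuppP => i iN; apply/eqP/negPn/negP => h; apply: h2; exists i.
- by apply/rowP => j; apply/eqP/negPn/negP => h; apply: h3; exists j.
Unshelve. all: by end_near.
Qed.

Lemma fan_coord_scale (k : R) b : 0 < k ->
  fan_coord A K (k *: b) = k *: fan_coord A K b.
Proof.
move=> k0; have [h1 h2 h3] := fan_coordP b; apply: fan_coordE; split.
- by move=> i; rewrite mxE mulr_ge0 // ltW.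
- apply: face_sub h2 _; apply/csuppP => i; rewrite inE negbK mxE => /eqP ->.
  by rewrite mulr0.
- by rewrite -scalemxAl h3.
Qed.

Lemma fan_coord_charv (s : {set 'I_v}) : s \in K ->
  fan_coord A K (charv s *m A) = charv s.
Proof.
move=> sK; apply: fan_coordE; split=> //; first by move=> i; rewrite mxE ler0n.
by apply: face_sub sK _; apply/csuppP => i /negbTE iN; rewrite mxE iN.
Qed.

(** [charv s *m A] is the sum of the generators of the cone of s, an interior point
    of that cone: all cones that meet a small neighbourhood of it have s as a face. *)
Lemma fan_coord_near_face (s : {set 'I_v}) : s \in K ->
  \forall b \near charv s *m A, forall i, i \in s -> 0 < fan_coord A K b ord0 i.
Proof.
move=> sK; apply: (filter_forall (nbhs_filter (charv s *m A))) => i.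
have [si|siN] := boolP (i \in s); last by near=> b.
have : fan_coord A K b ord0 i @[b --> charv s *m A] --> (1 : R).
  have -> : 1 = fan_coord A K (charv s *m A) ord0 i.
    by rewrite fan_coord_charv // mxE si.
  apply: (cvg_coord (F := nbhs (charv s *m A))); exact: fan_coord_continuous.
move=> c; near=> b => _; near: b; exact: (cvgr_gt _ c).
Unshelve. all: by end_near.
Qed.

(** Purity of a complete fan.  Let t be a maximal face containing s.  Moving the
    interior point [charv t *m A] a little towards b stays, by
    [fan_coord_near_face] and maximality, in the cone of t; hence the vectors of t
    span the whole space. *)
Lemma facet_extends (s : {set 'I_v}) : s \in K ->
  exists2 t : {set 'I_v}, t \in K /\ s \subset t &
    #|t| = D /\ forall b, exists2 c, csupp c \subset t & c *m A = b.
Proof.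
move=> sK; have [t /maxsetP[tK tmax] st] := @maxset_exists _ (fun s => s \in K) s sK.
exists t => //.
have span b : exists2 c, csupp c \subset t & c *m A = b.
  have : \forall k \near (0 : R)^'+, forall i, i \in t ->
      0 < fan_coord A K (charv t *m A + k *: b) ord0 i.
    have : charv t *m A + k *: b @[k --> (0 : R)] --> charv t *m A.
      have {2}-> : charv t *m A = charv t *m A + 0 *: b by rewrite scale0r addr0.
      by apply: cvgD; [exact: cvg_cst|apply: cvgZr_tmp; exact: cvg_id].
    by move=> /(_ _ (fan_coord_near_face tK)) /cvg_at_right_filter; apply.
  have : \forall k \near (0 : R)^'+, 0 < k by exact: nbhs_right_gt.
  move=> k0 hk; have [k []] := filter_ex (filterI k0 hk).
  set c := fan_coord _ _ _; move=> kgt0 cpos.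
  have [_ cK cA] := fan_coordP (charv t *m A + k *: b).
  have ct : csupp c = t.
    apply: tmax => //; apply/fintype.subsetP => i it.
    by rewrite inE gt_eqF // cpos.
  exists (k^-1 *: (c - charv t)).
    apply/csuppP => i iN; rewrite !mxE (negbTE iN).
    by rewrite (csuppP c t _) ?ct // subrr mulr0.
  by rewrite -scalemxAl mulmxBl cA addrC addKr scalerA mulVf ?scale1r ?gt_eqF.
split=> //.
(* the rows of A indexed by t form an invertible, hence square, matrix *)
pose At := rowsub (@enum_val _ (mem t)) A.
have expand (r : 'rV[R]_#|t|) : exists c, [/\ csupp c \subset t,
    r *m At = c *m A & forall i, c ord0 (enum_val i) = r ord0 i].
  exists (\row_i if i \in t =P true is ReflectT h
                 then r ord0 (enum_rank_in h i) else 0).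
  have E i : (\row_i if i \in t =P true is ReflectT h
      then r ord0 (enum_rank_in h i) else 0) ord0 (enum_val i) = r ord0 i.
    rewrite mxE; case: eqP => [h|]; first by rewrite enum_valK_in.
    by rewrite (enum_valP i).
  split=> //.
    apply/csuppP => i iN; rewrite mxE; case: eqP => // h.
    by rewrite h in iN.
  apply/rowP => j; rewrite !mxE.
  rewrite [RHS](bigID (mem t)) /= [X in _ = _ + X]big1 ?addr0; last first.
    move=> i iN; rewrite mxE; case: eqP => // h; last by rewrite mul0r.
    by rewrite h in iN.
  rewrite [RHS]big_enum_val /=; apply: eq_bigr => i _.
  by rewrite -[in LHS]E !mxE.
have fr : row_free At.
  apply: inj_row_free => r rA; have [c [cs e ec]] := expand r.
  have c0 : c = 0 by apply: (face_independent tK cs); rewrite -e.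
  by apply/rowP => i; rewrite -ec c0 !mxE.
have fu : row_full At.
  rewrite -sub1mx; apply/row_subP => i.
  have [c cs <-] := span (row i 1%:M).
  apply/submxP; exists (\row_i c ord0 (enum_val i)).
  have [c' [cs' -> ec']] := expand (\row_i c ord0 (enum_val i)).
  suff -> : c' = c by [].
  apply/rowP => k; have [kt|kN] := boolP (k \in t); last first.
    by rewrite (csuppP _ _ cs) // (csuppP _ _ cs').
  have := ec' (enum_rank_in kt k); rewrite mxE enum_rankK_in //.
by move: fr fu => /eqP fr /eqP fu; rewrite -fr fu.
Qed.

Lemma fan_rank : \rank A = D.
Proof.
have [t _ [_ span]] := facet_extends face0.
apply/eqP; rewrite -[_ == _]/(row_full A) -sub1mx; apply/row_subP => i.
by have [c _ <-] := span (row i 1%:M); exact: submxMl.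
Qed.

End CompleteFans.

(** * The fan of a starshaped sphere *)

Section StarshapedSpheres.
Variables (R : realType) (v d : nat) (K : {set {set 'I_v}}).

Lemma simplex_hullP (k : nat) (x : 'I_v -> 'rV[R]_k) (s : {set 'I_v}) y :
  simplex_hull x s y <-> exists c : 'rV[R]_v, [/\ forall i, 0 <= c ord0 i,
    csupp c \subset s, \sum_i c ord0 i = 1 & y = \sum_i c ord0 i *: x i].
Proof.
split=> [[t [t0 ts t1 ->]]|[c [c0 /csuppP cs c1 ->]]]; last by exists (c ord0).
exists (\row_i t i); split.
- by move=> i; rewrite mxE.
- by apply/csuppP => i iN; rewrite mxE ts.
- by rewrite -t1; apply: eq_bigr => i _; rewrite mxE.
- by apply: eq_bigr => i _; rewrite mxE.
Qed.

(** The realization of a complex with at most one vertex has at most one point,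
    whereas a sphere contains both e and - e. *)
Lemma sphere_not_point : simplicial_sphere R d K -> (1 < v)%N.
Proof.
move=> [_ [h [g [_ _ hK gK]]]]; rewrite ltnNge; apply/negP => v1.
pose e : 'rV[R]_d.+1 := delta_mx ord0 ord0.
have sum_e (k : R) : k ^+ 2 = 1 -> @unit_sphere R d (k *: e).
  move=> k1; rewrite /unit_sphere /= big_ord_recl big1 ?addr0; last first.
    by move=> i _; rewrite !mxE /= mulr0 expr0n.
  by rewrite !mxE /= mulr1.
pose a : set_type (@unit_sphere R d) :=
  exist _ (1 *: e) (mem_set (sum_e 1 (expr1n _ _))).
pose b : set_type (@unit_sphere R d) :=
  exist _ (-1 *: e) (mem_set (sum_e (-1) (etrans (@sqrrN R 1) (expr1n _ _)))).
have point (y z : set_type (@geometric_realization R v K)) : y = z.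
  case: y => y yP; case: z => z zP; apply: val_inj => /=.
  move: yP zP => /set_mem[s _ /simplex_hullP[c [_ _ c1 ->]]].
  move=> /set_mem[s' _ /simplex_hullP[c' [_ _ c1' ->]]].
  apply: eq_bigr => i _; congr (_ *: _); move: i c c' c1 c1'.
  case: v v1 => [|[|]] //= _; first by case.
  by move=> i c c'; rewrite (ord1 i) !big_ord1 => -> ->.
have ab : a = b by rewrite -(gK a) -(gK b) (point (g a) (g b)).
have : (val a : 'rV[R]_d.+1) ord0 ord0 = val b ord0 ord0 by rewrite ab.
by rewrite /= !mxE /= !mulr1 => /eqP; rewrite -subr_eq0 opprK -mulr2n pnatr_eq0.
Qed.

Variables (p0 : 'rV[R]_d.+1) (x : 'I_v -> 'rV[R]_d.+1).
Hypothesis complexK : simplicial_complex K.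
Hypothesis vertexK : has_full_vertex_set K.
Hypothesis vK : (1 < v)%N.
Hypothesis straightK : straight_realization x K.
Hypothesis starK : forall u : 'rV[R]_d.+1, u != 0 ->
  exists! y, (ray p0 u `&` polyhedron x K) y.

(** The rows are the vectors a_i from the center p0 to the vertices. *)
Definition star_matrix : 'M[R]_(v, d.+1) := \matrix_(i, j) (x i - p0) ord0 j.

Lemma mul_star_matrix (c : 'rV[R]_v) :
  c *m star_matrix = \sum_i c ord0 i *: x i - (\sum_i c ord0 i) *: p0.
Proof.
apply/rowP => j; rewrite !mxE summxE mulr_suml -sumrB.
by apply: eq_bigr => i _; rewrite !mxE mulrBr.
Qed.

Lemma polyhedron_vertex i : polyhedron x K (x i).
Proof.
exists [set i]%SET; first exact: vertexK.
exists (fun k => (k == i)%:R); split.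
- by move=> k; rewrite ler0n.
- by move=> k; rewrite inE => /negbTE ->.
- by rewrite (bigD1 i) //= eqxx big1 ?addr0 // => k /negbTE ->.
- by rewrite (bigD1 i) //= eqxx scale1r big1 ?addr0 // => k /negbTE ->; rewrite scale0r.
Qed.

(** If p0 belonged to the polyhedron then every ray from p0 would meet it in p0
    only, so that two distinct vertices would both sit at p0. *)
Lemma center_notin_polyhedron : ~ polyhedron x K p0.
Proof.
move=> Kp0.
have xp i : x i = p0.
  apply/eqP/negPn/negP => xN.
  have u0 : x i - p0 != 0 by rewrite subr_eq0.
  have [y [_ yu]] := starK u0.
  have yx : y = x i.
    apply: yu; split; last exact: polyhedron_vertex.
    by exists 1 => /=; rewrite ?ler01 // scale1r addrC subrK.
  have yp : y = p0.
    by apply: yu; split=> //; exists 0 => /=; rewrite ?lexx // scale0r addr0.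
  by rewrite -yx yp eqxx in xN.
have [v0 v1] : (0 < v)%N /\ (1 < v)%N by split=> //; exact: ltnW.
pose i := Ordinal v0; pose j := Ordinal v1.
have [_ /(_ [set i]%SET [set j]%SET (vertexK i) (vertexK j))] := straightK.
have -> : ([set i] :&: [set j])%SET = finset.set0.
  by apply/setP => k; rewrite !inE; case: eqP => // ->.
move=> /seteqP[/(_ p0) + _]; case.
  have self k : simplex_hull x [set k]%SET p0.
    exists (fun k' => (k' == k)%:R); split.
    - by move=> k'; rewrite ler0n.
    - by move=> k'; rewrite inE => /negbTE ->.
    - by rewrite (bigD1 k) //= eqxx big1 ?addr0 // => k' /negbTE ->.
    - rewrite (bigD1 k) //= eqxx scale1r big1 ?addr0 // => k' /negbTE ->.
      by rewrite scale0r.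
  by split.
move=> t [_ t0 t1 _]; move: t1; rewrite big1 => [|k _]; last by rewrite t0 ?inE.
by move/eqP; rewrite eq_sym oner_eq0.
Qed.

(** Simplices meet along common faces, so barycentric coordinates in the polyhedron
    do not depend on the simplex that is used. *)
Lemma hull_unique (c c' : 'rV[R]_v) :
  csupp c \in K -> csupp c' \in K ->
  (forall i, 0 <= c ord0 i) -> (forall i, 0 <= c' ord0 i) ->
  \sum_i c ord0 i = 1 -> \sum_i c' ord0 i = 1 ->
  \sum_i c ord0 i *: x i = \sum_i c' ord0 i *: x i -> c = c'.
Proof.
have [indep inter] := straightK.
have sub_eq (b b' : 'rV[R]_v) : csupp b \in K -> csupp b' \subset csupp b ->
    \sum_i b ord0 i = 1 -> \sum_i b' ord0 i = 1 ->
    \sum_i b ord0 i *: x i = \sum_i b' ord0 i *: x i -> b = b'.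
  move=> bK b'b b1 b'1 e; apply/rowP => i; apply/eqP; rewrite -subr_eq0; apply/eqP.
  apply: (indep _ bK (fun i => b ord0 i - b' ord0 i)) => [k kN||].
  - by rewrite (csuppP b _ (subxx _)) // (csuppP _ _ b'b) // subrr.
  - by rewrite sumrB b1 b'1 subrr.
  - by under eq_bigr do rewrite scalerBl; rewrite sumrB e subrr.
move=> cK c'K c0 c'0 c1 c'1 e.
have : (simplex_hull x (csupp c) `&` simplex_hull x (csupp c'))
    (\sum_i c ord0 i *: x i).
  split; apply/simplex_hullP; first by exists c.
  by exists c'.
rewrite (inter _ _ cK c'K) => /simplex_hullP[b [_ bs b1 eb]].
move: bs; rewrite finset.subsetI => /andP[bc bc'].
by rewrite (sub_eq c b) // (sub_eq c' b) // -e.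
Qed.

(** Dividing by their sum turns conical coordinates of b into barycentric
    coordinates of the point where the ray from p0 along b meets the polyhedron. *)
Lemma normalize_point (c : 'rV[R]_v) : (forall i, 0 <= c ord0 i) ->
  csupp c \in K -> let S := \sum_i c ord0 i in 0 < S ->
  polyhedron x K (p0 + S^-1 *: (c *m star_matrix)) /\
  p0 + S^-1 *: (c *m star_matrix) = \sum_i (S^-1 *: c) ord0 i *: x i.
Proof.
move=> c0 cK S S0.
have e : p0 + S^-1 *: (c *m star_matrix) = \sum_i (S^-1 *: c) ord0 i *: x i.
  rewrite mul_star_matrix scalerBr scalerA mulVf ?gt_eqF // scale1r addrC subrK.
  by rewrite scaler_sumr; apply: eq_bigr => i _; rewrite mxE scalerA.
split=> //; exists (csupp c) => //; apply/simplex_hullP.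
exists (S^-1 *: c); split=> //.
- by move=> i; rewrite mxE mulr_ge0 // invr_ge0 ltW.
- by apply/csuppP => i; rewrite inE negbK mxE => /eqP ->; rewrite mulr0.
- by under eq_bigr do rewrite mxE; rewrite -mulr_sumr mulVf // gt_eqF.
Qed.

Lemma starshaped_fan : complete_fan star_matrix K.
Proof.
split=> // b.
have sum_gt0 (c : 'rV[R]_v) : (forall i, 0 <= c ord0 i) -> c != 0 ->
    0 < \sum_i c ord0 i.
  move=> c0 cN; rewrite lt0r sumr_ge0 // andbT; apply: contra cN => /eqP s0.
  apply/eqP/rowP => i; rewrite mxE.
  apply/eqP; move/eqP: s0; rewrite psumr_eq0 // => /allP/(_ i); apply.
  by rewrite mem_index_enum.
have [->|bN] := eqVneq b 0.
  exists 0; split.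
    split; first by move=> i; rewrite mxE.
      suff -> : csupp (0 : 'rV[R]_v) = finset.set0 by have [] := complexK.
      by apply/setP => i; rewrite !inE mxE eqxx.
    by rewrite mul0mx.
  move=> c [c0 cK cA]; apply/eqP; rewrite eq_sym; apply/negPn/negP => cN.
  have [+ _] := normalize_point c0 cK (sum_gt0 c c0 cN).
  by rewrite cA scaler0 addr0; exact: center_notin_polyhedron.
have [y [[[t /= t0 yt] [s sK ys]] yu]] := starK bN.
have tN : t != 0.
  apply/eqP => te; apply: center_notin_polyhedron.
  by exists s => //; move: ys; rewrite -yt te scale0r addr0.
have {}t0 : 0 < t by rewrite lt0r tN.
have [c [c0 cs c1 cy]] := (iffLR (simplex_hullP _ _ _)) ys.
exists (t^-1 *: c); split.
  split; first by move=> i; rewrite mxE mulr_ge0 // invr_ge0 ltW.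
    have [_ sub] := complexK; apply: sub sK _; apply/csuppP => i iN.
    by rewrite mxE (csuppP _ _ cs) // mulr0.
  rewrite -scalemxAl mul_star_matrix c1 scale1r -cy -yt addrC addKr.
  by rewrite scalerA mulVf // scale1r.
move=> c' [c'0 c'K c'A].
have c'N : c' != 0.
  by apply: contra bN => /eqP c'e; rewrite -c'A c'e mul0mx.
have S0 := sum_gt0 _ c'0 c'N.
have [poly e] := normalize_point c'0 c'K S0.
set S := \sum_i _ in S0 poly e.
have yS : y = p0 + S^-1 *: (c' *m star_matrix).
  apply: yu; split=> //; exists S^-1; first by rewrite /= invr_ge0 ltW.
  by rewrite c'A.
have tS : t = S^-1.
  move: yS; rewrite -yt c'A => /addrI/eqP; rewrite -subr_eq0 -scalerBl.
  by rewrite scaler_eq0 (negbTE bN) orbF subr_eq0 => /eqP.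
rewrite tS invrK.
suff -> : c = S^-1 *: c' by rewrite scalerA divff ?scale1r // gt_eqF.
apply: hull_unique => //.
- by have [_ sub] := complexK; exact: sub sK cs.
- have [_ sub] := complexK; apply: sub c'K _; apply/csuppP => i.
  by rewrite inE negbK mxE => /eqP ->; rewrite mulr0.
- by move=> i; rewrite mxE mulr_ge0 // invr_ge0 ltW.
- by under eq_bigr do rewrite mxE; rewrite -mulr_sumr mulVf // gt_eqF.
- by rewrite -cy yS e.
Qed.

End StarshapedSpheres.

Lemma rationally_starshaped_fan (R : realType) (v d : nat)
    (K : {set {set 'I_v}}) : has_full_vertex_set K ->
  rationally_starshaped_sphere R d K ->
  exists A : 'M[R]_(v, d.+1), complete_fan A K.
Proof.
move=> vertexK [sphK [L [p0 [x [_ _ straightK _ starK]]]]].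
exists (star_matrix p0 x); apply: starshaped_fan => //; first by case: sphK.
exact: sphere_not_point sphK.
Qed.

(** * Modulus, exponential and logarithm of complex numbers *)

Section ComplexModulus.
Variable R : realType.
Implicit Types z w : CC R.

Definition cmod z : R := Num.sqrt (complex.Re z ^+ 2 + complex.Im z ^+ 2).

Lemma cmodE z : `|z| = (cmod z)%:C%C.
Proof. exact: normc_def. Qed.

Lemma cmod_ge0 z : 0 <= cmod z. Proof. exact: sqrtr_ge0. Qed.

Lemma cmodM z w : cmod (z * w) = cmod z * cmod w.
Proof. by apply: (@complexI R); rewrite [RHS]rmorphM -[LHS]cmodE normrM !cmodE. Qed.

Lemma cmod_eq0 z : (cmod z == 0) = (z == 0).
Proof. by rewrite -(inj_eq (@complexI R)) -cmodE; exact: normr_eq0. Qed.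

Lemma cmod_gt0 z : (0 < cmod z) = (z != 0).
Proof. by rewrite lt0r cmod_eq0 cmod_ge0 andbT. Qed.

Lemma normc_lt z (e : R) : (`|z| < e%:C%C) = (cmod z < e).
Proof. by rewrite cmodE ltcR. Qed.

Lemma Re_le_cmod z : `|complex.Re z| <= cmod z.
Proof. by rewrite -sqrtr_sqr ler_wsqrtr // lerDl sqr_ge0. Qed.

Lemma Im_le_cmod z : `|complex.Im z| <= cmod z.
Proof. by rewrite -sqrtr_sqr ler_wsqrtr // lerDr sqr_ge0. Qed.

Lemma cmod_le z : cmod z <= `|complex.Re z| + `|complex.Im z|.
Proof.
have s0 : 0 <= `|complex.Re z| + `|complex.Im z| by rewrite addr_ge0.
rewrite -[leRHS](ger0_norm s0) -[leRHS]sqrtr_sqr ler_wsqrtr // sqrrD.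
rewrite !real_normK ?num_real // lerD2r lerDl mulrn_wge0 ?mulr_ge0 //.
Qed.

Lemma cmod_real (a : R) : 0 <= a -> cmod a%:C%C = a.
Proof. by move=> a0; rewrite /cmod /= expr0n addr0 sqrtr_sqr ger0_norm. Qed.

(** In the order of the complex numbers, positive numbers are real; this reduces
    complex radii of balls to real ones. *)
Lemma pos_complex (e : CC R) : 0 < e -> exists2 e' : R, 0 < e' & e = e'%:C%C.
Proof.
case: e => a b; rewrite ltcE /= => /andP[/eqP -> a0].
by exists a.
Qed.

Lemma cvg_complexP (X : Type) (F : set_system X) {FF : Filter F}
    (f : X -> CC R) (l : CC R) :
  f @ F --> l <->
  (complex.Re (f x) @[x --> F] --> complex.Re l) /\
  (complex.Im (f x) @[x --> F] --> complex.Im l).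
Proof.
have ReB z w : complex.Re (z - w) = complex.Re z - complex.Re w.
  by case: z; case: w.
have ImB z w : complex.Im (z - w) = complex.Im z - complex.Im w.
  by case: z; case: w.
split=> [/cvgrPdist_lt cf|[/cvgrPdist_lt cr /cvgrPdist_lt ci]].
  split; apply/cvgrPdist_lt => e e0.
    have e0' : (0 : CC R) < e%:C%C by rewrite ltcR.
    apply: filterS (cf _ e0') => x; rewrite normc_lt -ReB.
    exact/le_lt_trans/Re_le_cmod.
  have e0' : (0 : CC R) < e%:C%C by rewrite ltcR.
  apply: filterS (cf _ e0') => x; rewrite normc_lt -ImB.
  exact/le_lt_trans/Im_le_cmod.
apply/cvgrPdist_lt => _ /pos_complex[e e0 ->].
have e2 : 0 < e / 2 by rewrite divr_gt0.
apply: filterS2 (cr _ e2) (ci _ e2) => x hr hi.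
rewrite normc_lt; apply: le_lt_trans (cmod_le _) _.
by rewrite ReB ImB [e]splitr ltrD.
Qed.

Lemma Re_continuous : continuous (@complex.Re R : CC R -> R).
Proof. by move=> z; apply: (iffLR (cvg_complexP (F := nbhs z) id z) _).1. Qed.

Lemma Im_continuous : continuous (@complex.Im R : CC R -> R).
Proof. by move=> z; apply: (iffLR (cvg_complexP (F := nbhs z) id z) _).2. Qed.

Lemma cmod_continuous : continuous cmod.
Proof.
move=> z; apply: (@continuous_comp _ _ _
  (fun z : CC R => complex.Re z ^+ 2 + complex.Im z ^+ 2) Num.sqrt).
  apply: (@cvgD _ _ _ (nbhs z)).
    by apply: (@continuous_comp _ _ _ (@complex.Re R : CC R -> R) (fun x => x ^+ 2));
       [exact: Re_continuous|exact: exprn_continuous].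
  by apply: (@continuous_comp _ _ _ (@complex.Im R : CC R -> R) (fun x => x ^+ 2));
     [exact: Im_continuous|exact: exprn_continuous].
exact: sqrt_continuous.
Qed.

End ComplexModulus.

Section ComplexExponential.
Variable R : realType.
Implicit Types z w h : CC R.

Lemma cexp_neq0 z : cexp z != 0.
Proof.
apply/eqP => z0; have := cexpD z (- z).
by rewrite subrr cexp0 z0 mul0r => /eqP; rewrite oner_eq0.
Qed.

Lemma cexpN z : cexp (- z) = (cexp z)^-1.
Proof.
by apply: (mulfI (cexp_neq0 z)); rewrite -cexpD subrr cexp0 mulfV // cexp_neq0.
Qed.

Lemma cmod_cexp z : cmod (cexp z) = expR (complex.Re z).
Proof.
rewrite /cmod /cexp /= !exprMn -mulrDr cos2Dsin2 mulr1 sqrtr_sqr.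
by rewrite ger0_norm // expR_ge0.
Qed.

Lemma cexp_real (a : R) : cexp a%:C%C = (expR a)%:C%C.
Proof. by rewrite /cexp /= cos0 sin0 mulr1 mulr0. Qed.

Lemma cexp_imaginary_eq1 (b : R) : `|b| < 2 -> cexp (Complex 0 b) = 1 -> b = 0.
Proof.
move=> b2; rewrite /cexp /= expR0 !mul1r => -[cb _].
have : cos `|b| = cos 0 by rewrite cos_norm cos0.
move=> /cos_inj/eqP; rewrite normr_eq0 => /(_ _ _)/eqP; apply.
  by rewrite in_itv /= normr_ge0 (le_trans (ltW b2)) // pi_ge2.
by rewrite in_itv /= lexx pi_ge0.
Qed.

(** A form of differentiability at 0 suited to combining estimates for expR, sin
    and cos. *)
Lemma derivative_bound (f : R -> R) (a : R) : is_derive (0 : R) 1 f a ->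
  forall e : R, 0 < e -> \forall h \near 0, `|f h - f 0 - a * h| <= e * `|h|.
Proof.
move=> [df fa] e e0; have := df; rewrite /derivable.
move=> /cvg_ex[l cl]; have la : l = a by rewrite -fa /derive; apply/esym/cvg_lim.
move/cvgrPdist_le : cl => /(_ e e0); rewrite la /dnbhs /= => cl.
have {cl} : \forall h \near (0 : R), h != 0 ->
    `|a - h^-1 *: (f (h *: 1 + 0) - f 0)| <= e by exact: cl.
apply: filterS => h hh; have [->|hN] := eqVneq h 0.
  by rewrite subrr mulr0 subrr normr0 mulr0.
move: (hh hN); rewrite addr0 scaler1 => {}hh.
have -> : f h - f 0 - a * h = - (a - h^-1 *: (f h - f 0)) * h.
  by rewrite /GRing.scale /=; field.
by rewrite normrM normrN ler_wpM2r.
Qed.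

Lemma near0_cmod (P : CC R -> Prop) (Q : R -> R -> Prop) :
  (forall h, Q (complex.Re h) (complex.Im h) -> P h) ->
  (\forall a \near (0 : R) & b \near (0 : R), Q a b) -> \forall h \near (0 : CC R), P h.
Proof.
move=> QP [[U V] /= [U0 V0] UVQ].
have hU : \forall h \near (0 : CC R), U (complex.Re h) by exact: Re_continuous.
have hV : \forall h \near (0 : CC R), V (complex.Im h) by exact: Im_continuous.
by apply: filterS2 hU hV => h Uh Vh; apply: QP; exact: (UVQ (_, _)).
Qed.

(** With h = a + i b, the real and imaginary parts of exp h - 1 - h are
    (e^a - 1 - a) + e^a (cos b - 1) and (sin b - b) + (e^a - 1) sin b. *)
Lemma cexp_first_order (e : R) : 0 < e ->
  \forall h \near (0 : CC R), cmod (cexp h - 1 - h) <= e * cmod h.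
Proof.
move=> e0.
(* the estimates below add up to 9 d |h| *)
pose d := Num.min (e / 16) 1.
have d0 : 0 < d by rewrite lt_min divr_gt0 //= ltr01.
have [d1 de] : d <= 1 /\ d <= e / 16 by rewrite !ge_min !lexx orbT.
have hE : \forall a \near (0 : R), `|expR a - 1 - a| <= d * `|a|.
  have := derivative_bound (is_derive_expR 0) d0.
  by apply: filterS => a; rewrite expR0 mul1r.
have hS : \forall b \near (0 : R), `|sin b - b| <= d * `|b|.
  have := derivative_bound (is_derive_sin 0) d0.
  by apply: filterS => a; rewrite sin0 cos0 mul1r subr0.
have hC : \forall b \near (0 : R), `|cos b - 1| <= d * `|b|.
  have := derivative_bound (is_derive_cos 0) d0.
  by apply: filterS => a; rewrite sin0 cos0 oppr0 mul0r subr0.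
have hd : \forall b \near (0 : R), `|b| <= d by exact: nbhs0_le.
apply: (near0_cmod (Q := fun a b => [/\ `|expR a - 1 - a| <= d * `|a|, `|a| <= d
  & [/\ `|sin b - b| <= d * `|b|, `|cos b - 1| <= d * `|b| & `|b| <= d]])); last first.
  exists ([set a | `|expR a - 1 - a| <= d * `|a| /\ `|a| <= d],
          [set b | [/\ `|sin b - b| <= d * `|b|, `|cos b - 1| <= d * `|b| & `|b| <= d]]).
    split=> /=; first exact: filterI.
    by apply: filterS3 hS hC hd.
  by move=> [a b] /= [[? ?] ?]; split.
case=> a b /= [Ea ad [Sb Cb bd]].
apply: le_trans (cmod_le _) _ => /=.
have am := Re_le_cmod (Complex a b); have bm := Im_le_cmod (Complex a b).
move: am bm; set m := cmod _ => /= am bm.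
have Ea1 : `|expR a - 1| <= 2 * `|a|.
  have -> : expR a - 1 = (expR a - 1 - a) + a by rewrite subrK.
  apply: le_trans (ler_normD _ _) _.
  have : d * `|a| <= 1 * `|a| by rewrite ler_wpM2r.
  lra.
have Sb1 : `|sin b| <= 2 * d.
  have -> : sin b = (sin b - b) + b by rewrite subrK.
  apply: le_trans (ler_normD _ _) _.
  have : d * `|b| <= 1 * `|b| by rewrite ler_wpM2r.
  lra.
have E3 : `|expR a| <= 3.
  have -> : expR a = (expR a - 1) + 1 by rewrite subrK.
  apply: le_trans (ler_normD _ _) _; rewrite normr1.
  have := normr_ge0 a; lra.
have -> : expR a * cos b - 1 - a = (expR a - 1 - a) + expR a * (cos b - 1) by ring.
have -> : expR a * sin b - 0 - b = (sin b - b) + (expR a - 1) * sin b by ring.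
have h1 : `|expR a - 1 - a + expR a * (cos b - 1)| <= d * `|a| + 3 * (d * `|b|).
  apply: le_trans (ler_normD _ _) _; rewrite lerD // normrM.
  exact: ler_pM.
have h2 : `|sin b - b + (expR a - 1) * sin b| <= d * `|b| + 2 * `|a| * (2 * d).
  apply: le_trans (ler_normD _ _) _; rewrite lerD // normrM.
  exact: ler_pM.
have h3 : d * `|a| <= (e / 16) * m by rewrite ler_pM // ltW.
have h4 : d * `|b| <= (e / 16) * m by rewrite ler_pM // ltW.
have h5 : 2 * `|a| * (2 * d) = 4 * (d * `|a|) by ring.
have h6 : 0 <= e * m by rewrite mulr_ge0 ?cmod_ge0 // ltW.
lra.
Qed.

Lemma cexp_derivable z : derivable (@cexp R : CC R -> CC R) z 1.
Proof.
apply/cvg_ex; exists (cexp z : CC R); apply/cvgrPdist_le => _ /pos_complex[e e0 ->].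
pose c := cmod (cexp z); have c0 : 0 < c by rewrite cmod_gt0 cexp_neq0.
have e'0 : 0 < e / c by rewrite divr_gt0.
apply: filterS (cexp_first_order e'0) => h hh hN.
have -> : cexp z - h^-1 *: (cexp (h *: 1 + z) - cexp z) =
    - (cexp z * h^-1 * (cexp h - 1 - h)).
  have -> : h *: (1 : CC R) = h by rewrite /GRing.scale /= mulr1.
  by rewrite cexpD /GRing.scale /=; field.
rewrite normrN cmodE !cmodM lecR -/c.
apply: (@le_trans _ _ (c * cmod h^-1 * (e / c * cmod h))).
  by rewrite ler_wpM2l // mulr_ge0 ?cmod_ge0 ?ltW.
have -> : c * cmod h^-1 * (e / c * cmod h) = (c / c) * (cmod (h^-1 * h)) * e.
  by rewrite cmodM; ring.
rewrite mulVf // divff ?gt_eqF // mul1r.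
have -> : cmod (1 : CC R) = 1 by rewrite cmod_real.
by rewrite mul1r.
Qed.

Lemma cexp_differentiable z : differentiable (@cexp R : CC R -> CC R) z.
Proof. exact/derivable1_diffP/cexp_derivable. Qed.

Lemma cexp_continuous : continuous (@cexp R : CC R -> CC R).
Proof. by move=> z; apply: differentiable_continuous; exact: cexp_differentiable. Qed.

(** The principal branch, meant for arguments with positive real part. *)
Definition clog z : CC R :=
  Complex (ln (cmod z)) (atan (complex.Im z / complex.Re z)).

Lemma clog1 : clog 1 = 0.
Proof.
by rewrite /clog /= mul0r atan0 (@cmod_real _ 1) // ln1.
Qed.

Lemma clogK z : 0 < complex.Re z -> cexp (clog z) = z.
Proof.
move=> z0; have mz : 0 < cmod z.
  by rewrite cmod_gt0; apply: contraTneq z0 => ->; rewrite ltxx.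
rewrite /cexp /clog /= lnK ?posrE // cos_atan.
set u := complex.Im z / complex.Re z; have cN : cos (atan u) != 0.
  by rewrite cos_atan invr_neq0 // sqrtr_eq0 -ltNge ltr_wpDr // sqr_ge0.
have -> : sin (atan u) = u * cos (atan u).
  by rewrite -[X in _ = X * _](atanK u) /tan divfK.
rewrite cos_atan.
have -> : cmod z = complex.Re z * Num.sqrt (1 + u ^+ 2).
  rewrite -[X in X * _]ger0_norm ?ltW // -sqrtr_sqr -sqrtrM ?sqr_ge0 //.
  congr Num.sqrt; rewrite mulrDr mulr1 -exprMn; congr (_ + _ ^+ 2).
  by rewrite mulrC divfK // gt_eqF.
have sN : Num.sqrt (1 + u ^+ 2) != 0.
  by rewrite sqrtr_eq0 -ltNge ltr_wpDr // sqr_ge0.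
rewrite mulfK // [u * _]mulrC mulrA mulfK // mulrC divfK ?gt_eqF //.
by case: z {z0 mz u cN sN}.
Qed.

Lemma clog_continuous1 : {for (1 : CC R), continuous clog}.
Proof.
have c1 : 0 < cmod (1 : CC R) by rewrite (@cmod_real _ 1).
have h1 : {for (1 : CC R), continuous (@ln R \o @cmod R)}.
  apply: continuous_comp; first exact: cmod_continuous.
  exact: (continuous_ln c1).
have h2 : {for (1 : CC R), continuous
    (@atan R \o (fun z : CC R => complex.Im z / complex.Re z))}.
  apply: continuous_comp; last exact: continuous_atan.
  apply: (@cvgM _ _ (nbhs (1 : CC R))); first exact: Im_continuous.
  apply: (@cvgV _ _ (nbhs (1 : CC R))); first exact: oner_neq0.
  exact: (@Re_continuous R (1 : CC R)).
by apply/(cvg_complexP (F := nbhs (1 : CC R))); split.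
Qed.

Lemma clogK_near1 : \forall z \near (1 : CC R), cexp (clog z) = z.
Proof.
have : complex.Re z @[z --> (1 : CC R)] --> (1 : R).
  exact: (@Re_continuous R (1 : CC R)).
move=> /cvgr_gt/(_ 0 ltr01); apply: filterS => z; exact: clogK.
Qed.

(** With w = clog (1 + h) one has 1 + h = cexp w = 1 + w + o(w), so w = h + o(h). *)
Lemma clog_derivable1 : derivable clog (1 : CC R) 1.
Proof.
apply/cvg_ex; exists (1 : CC R); apply/cvgrPdist_le => _ /pos_complex[e e0 ->].
pose d := Num.min (e / 2) 2^-1.
have d0 : 0 < d by rewrite lt_min divr_gt0 //= invr_gt0.
have [de d2] : d <= e / 2 /\ d <= 2^-1 by rewrite !ge_min !lexx orbT.
have shift : h + 1 @[h --> (0 : CC R)] --> (1 : CC R).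
  have {2}-> : (1 : CC R) = 0 + 1 by rewrite add0r.
  by apply: (@cvgD _ _ _ (nbhs (0 : CC R))); [exact: cvg_id|exact: cvg_cst].
have H1 : \forall h \near (0 : CC R), cexp (clog (h + 1)) = h + 1.
  by exact: shift clogK_near1.
have H2 : \forall h \near (0 : CC R),
    cmod (cexp (clog (h + 1)) - 1 - clog (h + 1)) <= d * cmod (clog (h + 1)).
  have c : clog (h + 1) @[h --> (0 : CC R)] --> clog 1.
    exact: (@cvg_comp _ _ _ (fun h : CC R => h + 1) clog _ _ _ shift clog_continuous1).
  by rewrite clog1 in c; exact: c (cexp_first_order d0).
apply: filterS2 H1 H2 => h e1 + hN; rewrite e1 addrK.
have -> : h *: (1 : CC R) = h by rewrite /GRing.scale /= mulr1.
rewrite clog1 subr0; set w := clog _ => hw.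
have -> : 1 - h^-1 *: w = h^-1 * (h - w).
  by rewrite /GRing.scale /= mulrBr mulVf.
rewrite cmodE cmodM lecR.
have h0 : 0 < cmod h by rewrite cmod_gt0.
have wh : cmod w <= cmod h + cmod (h - w).
  rewrite -lecR rmorphD /= -!cmodE.
  have {1}-> : w = h - (h - w) by rewrite subKr.
  exact: ler_normB.
have : cmod h * cmod h^-1 = 1 by rewrite -cmodM mulfV // cmod_real.
set k := cmod h^-1 => hk.
have k0 : 0 < k by rewrite cmod_gt0 invr_neq0.
rewrite -(ler_pM2l h0) mulrA hk mul1r.
have : d * cmod w <= 2^-1 * cmod w by rewrite ler_wpM2r // cmod_ge0.
have : d * cmod w <= e / 2 * cmod w by rewrite ler_wpM2r // cmod_ge0.
move=> q1 q2.
have w2 : cmod w <= 2 * cmod h by lra.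
have : e / 2 * cmod w <= e / 2 * (2 * cmod h).
  by rewrite ler_wpM2l // divr_ge0 // ltW.
lra.
Qed.

Lemma clog_differentiable1 : differentiable clog (1 : CC R).
Proof. exact/derivable1_diffP/clog_derivable1. Qed.

End ComplexExponential.

(** * The flow generated by the linear relations *)

Section MomentAngle.
Variables (R : realType) (v : nat) (K : {set {set 'I_v}}).
Implicit Types (x z : 'rV[CC R]_v).

Lemma moment_angleP z : simplicial_complex K ->
  moment_angle R K z <-> (forall j, cmod (z ord0 j) <= 1) /\
    [set j | cmod (z ord0 j) != 1]%SET \in K.
Proof.
have le1 (w : CC R) : (`|w| <= 1) = (cmod w <= 1) by rewrite cmodE -lecR.
have eq1 (w : CC R) : `|w| = 1 <-> cmod w = 1.
  by rewrite cmodE; split=> [|->//]; exact: (@complexI R _ 1).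
move=> [_ sub]; split=> [[s sK [z1 zs]]|[z1 zK]].
  split=> [j|]; first by rewrite -le1.
  apply: sub sK _; apply/fintype.subsetP => j; rewrite inE.
  by apply: contraNT => /zs/eq1 ->.
exists [set j | cmod (z ord0 j) != 1]%SET => //; split=> j; first by rewrite le1.
by rewrite inE negbK => /eqP h; apply/eq1.
Qed.

Definition zero_set x : {set 'I_v} := [set j | x ord0 j == 0]%SET.

(** The complement of the coordinate subspace arrangement of K. *)
Definition arrangement_compl : set 'rV[CC R]_v := [set x | zero_set x \in K].

Lemma moment_angle_compl z : simplicial_complex K ->
  moment_angle R K z -> arrangement_compl z.
Proof.
move=> cK /(moment_angleP _ cK)[_ zK]; have [_ sub] := cK; apply: sub zK _.
apply/fintype.subsetP => j; rewrite !inE => /eqP ->.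
by rewrite (@cmod_real _ 0) // eq_sym oner_eq0.
Qed.

End MomentAngle.

Section Flow.
Variables (R : realType) (v D : nat) (A : 'M[R]_(v, D)) (K : {set {set 'I_v}}).
Hypothesis fanAK : complete_fan A K.

Definition relations : 'M[R]_(\rank (kermx A), v) := row_base (kermx A).
Notation m := (\rank (kermx A)).
Notation B := relations.
Implicit Types (t : 'rV[R]_m) (x z : 'rV[CC R]_v).

Let complexK : simplicial_complex K. Proof. by case: fanAK. Qed.

Lemma relationsA t : t *m B *m A = 0.
Proof.
apply/sub_kermxP; rewrite /B; apply: submx_trans (submxMl _ _) _.
by rewrite eq_row_base.
Qed.

Lemma relations_inj t : t *m B = 0 -> t = 0.
Proof. by move/eqP; rewrite mulmx_free_eq0 ?row_base_free // => /eqP. Qed.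

Lemma relations_coord (c : 'rV[R]_v) : c *m A = 0 -> c *m pinvmx B *m B = c.
Proof.
by move=> cA; apply: mulmxKpV; rewrite eq_row_base; apply/sub_kermxP.
Qed.

Definition flow t x : 'rV[CC R]_v :=
  \row_j ((expR ((t *m B) ord0 j))%:C%C * x ord0 j).

Lemma flow0 x : flow 0 x = x.
Proof. by apply/rowP => j; rewrite mxE mul0mx mxE expR0 mul1r. Qed.

Lemma flowD s t x : flow s (flow t x) = flow (s + t) x.
Proof.
by apply/rowP => j; rewrite /flow mulmxDl !mxE expRD rmorphM mulrA.
Qed.

Lemma cmod_flow t x j :
  cmod (flow t x ord0 j) = expR ((t *m B) ord0 j) * cmod (x ord0 j).
Proof. by rewrite mxE cmodM cmod_real // expR_ge0. Qed.

Lemma flow_eq0 t x j : (flow t x ord0 j == 0) = (x ord0 j == 0).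
Proof. by rewrite -!cmod_eq0 cmod_flow mulf_eq0 gt_eqF // expR_gt0. Qed.

Lemma zero_set_flow t x : zero_set (flow t x) = zero_set x.
Proof. by apply/setP => j; rewrite !inE flow_eq0. Qed.

(** The vectors - ln |x_j| of the two points are nonnegative, supported on faces of
    K, and differ by the relation t B, so they are conical coordinates of the same
    vector. *)
Lemma flow_unique t x :
  moment_angle R K x -> moment_angle R K (flow t x) -> t = 0.
Proof.
move=> /(moment_angleP _ complexK)[x1 xK] /(moment_angleP _ complexK)[y1 yK].
pose r : 'rV[R]_v := t *m B.
(* where x_j = 0, the logarithms are infinite; they are replaced by any two
   nonnegative numbers that differ by r_j *)
pose c : 'rV[R]_v := \row_j if x ord0 j == 0 then Num.max (r ord0 j) 0
  else - ln (cmod (x ord0 j)).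
have crE j : (c - r) ord0 j = c ord0 j - r ord0 j by rewrite mxE [(- r) _ _]mxE.
have cr j : (c - r) ord0 j = if x ord0 j == 0 then Num.max 0 (- r ord0 j)
  else - ln (cmod (flow t x ord0 j)).
  rewrite crE mxE; case: ifPn => xj.
    by case: (lerP (r ord0 j) 0) => ?; case: (lerP 0 (- r ord0 j)) => ?; lra.
  by rewrite cmod_flow lnM ?posrE ?expR_gt0 ?cmod_gt0 // expRK opprD addrC.
have hc : cone_coords A K (c *m A) c.
  split=> // [j|].
    rewrite mxE; case: ifP => _; first by rewrite le_max lexx orbT.
    by rewrite oppr_ge0 ln_le0.
  apply: (face_sub fanAK xK); apply/csuppP => j; rewrite inE negbK mxE => /eqP h.
  by rewrite h ln1 oppr0 -cmod_eq0 h oner_eq0.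
have hcr : cone_coords A K (c *m A) (c - r).
  split; last by rewrite mulmxBl relationsA subr0.
    move=> j; rewrite cr; case: ifP => _; first by rewrite le_max lexx.
    by rewrite oppr_ge0 ln_le0.
  apply: (face_sub fanAK yK); apply/csuppP => j; rewrite inE negbK cr => /eqP h.
  by rewrite h ln1 oppr0 -(flow_eq0 t) -cmod_eq0 h oner_eq0.
apply: relations_inj; have /eqP := cone_coords_inj fanAK hc hcr.
by rewrite -subr_eq0 subKr => /eqP.
Qed.

(** Let y_j = - ln |x_j| where x0_j <> 0, and let y_j be a large constant on the zero
    set s of x0.  Then y minus its conical coordinates c is a relation, and flowing
    by it turns the logarithms y into c >= 0.  Since y is large on s, the
    coordinates c are positive on s; so the coordinates x_j with j in s, which may
    be 0 and have modulus less than exp (- y_j) near x0, end up with modulus less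
    than 1 without leaving the face on which c is supported. *)
Lemma flow_exists_near x0 : arrangement_compl K x0 ->
  exists T : 'rV[CC R]_v -> 'rV[R]_m, {for x0, continuous T} /\
    \forall x \near x0, moment_angle R K (flow (T x) x).
Proof.
move=> sK; set s := zero_set x0 in sK.
have offs j : j \notin s -> 0 < cmod (x0 ord0 j).
  by rewrite inE -cmod_gt0.
pose y0 : 'rV[R]_v := \row_j if j \in s then 0 else - ln (cmod (x0 ord0 j)).
have [k k0 kpos] : exists2 k : R, 0 < k &
    forall i, i \in s -> 0 < fan_coord A K ((charv R s + k *: y0) *m A) ord0 i.
  have : \forall k \near (0 : R)^'+, forall i, i \in s ->
      0 < fan_coord A K ((charv R s + k *: y0) *m A) ord0 i.
    have : (charv R s + k *: y0) *m A @[k --> (0 : R)] --> charv R s *m A.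
      have {2}-> : charv R s = charv R s + 0 *: y0 by rewrite scale0r addr0.
      apply: (mulmxr_cvg (F := nbhs (0 : R))).
      by apply: cvgD; [exact: cvg_cst|apply: cvgZr_tmp; exact: cvg_id].
    by move=> /(_ _ (fan_coord_near_face fanAK sK)) /cvg_at_right_filter; apply.
  move=> hk; have h0 : \forall k \near (0 : R)^'+, 0 < k by exact: nbhs_right_gt.
  by have [k []] := filter_ex (filterI h0 hk); exists k.
(* k^-1 is the large constant *)
pose y x : 'rV[R]_v := \row_j if j \in s then k^-1 else - ln (cmod (x ord0 j)).
have yx0 : y x0 = k^-1 *: (charv R s + k *: y0).
  apply/rowP => j; rewrite !mxE; case: ifP => _.
    by rewrite mulr0 addr0 mulr1.
  by rewrite add0r mulrA mulVf ?gt_eqF // mul1r.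
have coordc j : (fun x : 'rV[CC R]_v => x ord0 j) @ x0 --> x0 ord0 j.
  exact: coord_continuous.
have cmodc j : (fun x : 'rV[CC R]_v => cmod (x ord0 j)) @ x0 --> cmod (x0 ord0 j).
  apply: (@cvg_comp _ _ _ (fun x : 'rV[CC R]_v => x ord0 j) (@cmod R) _ _ _ (coordc j)).
  exact: cmod_continuous.
have yc : {for x0, continuous y}.
  apply: (cvg_mx (F := nbhs x0)) => i j; rewrite mxE; under eq_fun do rewrite mxE.
  case: ifPn => js; first exact: (@cvg_cst _ _ _ (nbhs x0)).
  apply: (cvgN (F := nbhs x0)).
  apply: (@cvg_comp _ _ _ (fun x : 'rV[CC R]_v => cmod (x ord0 j)) (@ln R) _ _ _ (cmodc j)).
  exact: (continuous_ln (offs j js)).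
pose c x := fan_coord A K (y x *m A).
have cc : {for x0, continuous c}.
  apply: (@continuous_comp _ _ _ (fun x => y x *m A) (fan_coord A K)).
    exact: (mulmxr_cvg (F := nbhs x0)).
  exact: fan_coord_continuous.
exists (fun x => (y x - c x) *m pinvmx B); split.
  by apply: (mulmxr_cvg (F := nbhs x0)); apply: (cvgB (F := nbhs x0)).
have cpos : \forall x \near x0, forall i, i \in s -> 0 < c x ord0 i.
  apply: (filter_forall (nbhs_filter x0)) => i.
  have [si|siN] := boolP (i \in s); last by near=> b.
  have : c x ord0 i @[x --> x0] --> c x0 ord0 i by exact: (cvg_coord (F := nbhs x0)).
  move=> /cvgr_gt/(_ 0) h; have {}h : \forall x \near x0, 0 < c x ord0 i.
    apply: h; rewrite /c yx0 -scalemxAl fan_coord_scale ?invr_gt0 // mxE.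
    by rewrite mulr_gt0 ?invr_gt0 // kpos.
  by apply: filterS h.
have offnear : \forall x \near x0, forall j, j \notin s ->
    0 < cmod ((x : 'rV[CC R]_v) ord0 j).
  apply: (filter_forall (nbhs_filter x0)) => j.
  have [si|siN] := boolP (j \in s); first by near=> b.
  by move/cvgr_gt: (cmodc j) => /(_ 0 (offs j siN)); apply: filterS.
have onnear : \forall x \near x0, forall j, j \in s ->
    cmod ((x : 'rV[CC R]_v) ord0 j) < expR (- k^-1).
  apply: (filter_forall (nbhs_filter x0)) => j.
  have [si|siN] := boolP (j \in s); last by near=> b.
  move/cvgr_lt: (cmodc j) => /(_ (expR (- k^-1))) h.
  have {}h : \forall x \near x0, cmod ((x : 'rV[CC R]_v) ord0 j) < expR (- k^-1).
    by apply: h; move: si; rewrite inE -cmod_eq0 => /eqP ->; exact: expR_gt0.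
  by apply: filterS h.
apply: filterS3 cpos offnear onnear => x cpos offnear onnear.
have [c0 cK cA] := fan_coordP fanAK (y x *m A).
have TB : (y x - c x) *m pinvmx B *m B = y x - c x.
  by apply: relations_coord; rewrite mulmxBl cA subrr.
have TBj j : ((y x - c x) *m pinvmx B *m B) ord0 j =
    (if j \in s then k^-1 else - ln (cmod (x ord0 j))) - c x ord0 j.
  by rewrite TB mxE [y x _ _]mxE [(- c x) _ _]mxE.
have on j : j \in s -> cmod (flow ((y x - c x) *m pinvmx B) x ord0 j) < 1.
  move=> js; rewrite cmod_flow TBj js.
  apply: (@lt_le_trans _ _ (expR (k^-1 - c x ord0 j) * expR (- k^-1))).
    by rewrite ltr_pM2l ?expR_gt0 // onnear.
  by rewrite -expRD addrAC subrr add0r -[leRHS]expR0 ler_expR oppr_le0 c0.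
have off j : j \notin s -> cmod (flow ((y x - c x) *m pinvmx B) x ord0 j) =
    expR (- c x ord0 j).
  move=> js; have xj := offnear j js.
  rewrite cmod_flow TBj (negbTE js) -[X in _ * X]lnK // -expRD.
  by rewrite addrAC addNr add0r.
apply/(moment_angleP _ complexK); split=> [j|].
  have [js|jN] := boolP (j \in s); first exact: ltW (on j js).
  by rewrite off // -[leRHS]expR0 ler_expR oppr_le0 c0.
apply: (face_sub fanAK cK); apply/fintype.subsetP => j; rewrite !inE.
have [js _|jN] := boolP (j \in s).
  by rewrite gt_eqF // cpos.
by rewrite off //; apply: contraNneq => ->; rewrite oppr0 expR0.
Unshelve. all: by end_near.
Qed.

Definition flow_time x : 'rV[R]_m := xget 0 [set t | moment_angle R K (flow t x)].

Lemma flow_timeP x : arrangement_compl K x -> moment_angle R K (flow (flow_time x) x).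
Proof.
move=> /flow_exists_near[T [_ /nbhs_singleton h]].
by apply: (@xgetPex _ _ [set t | moment_angle R K (flow t x)]); exists (T x).
Qed.

Lemma flow_timeE t x : moment_angle R K (flow t x) -> flow_time x = t.
Proof.
move=> h; have xK : arrangement_compl K x.
  by rewrite /arrangement_compl /= -(zero_set_flow t); exact: moment_angle_compl.
apply/eqP; rewrite -subr_eq0; apply/eqP; apply: flow_unique h _.
by rewrite flowD subrK; exact: flow_timeP.
Qed.

Lemma flow_time_flow t x : arrangement_compl K x ->
  flow_time (flow t x) = flow_time x - t.
Proof. by move=> xK; apply: flow_timeE; rewrite flowD subrK; exact: flow_timeP. Qed.

Lemma open_arrangement_compl : open (arrangement_compl K : set 'rV[CC R]_v).
Proof.
rewrite openE => x0 /flow_exists_near[T [_ hT]]; apply: filterS hT => x h.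
by rewrite /arrangement_compl /= -(zero_set_flow (T x)); exact: moment_angle_compl.
Qed.

Lemma flow_time_continuous x : arrangement_compl K x -> {for x, continuous flow_time}.
Proof.
move=> /flow_exists_near[T [Tc hT]].
have e : {near x, T =1 flow_time} by apply: filterS hT => x' h; rewrite (flow_timeE h).
rewrite /prop_for /continuous_at -(nbhs_singleton e).
exact: cvg_trans (near_eq_cvg e) Tc.
Qed.

End Flow.

(** * The LVMB system of a complete fan *)

Section ExtendComplex.
Variables (R : realType) (v q : nat) (K : {set {set 'I_v}}).

(** A ghost vertex contributes a coordinate of modulus 1. *)
Lemma moment_angle_row_mx (z : 'rV[CC R]_v) (w : 'rV[CC R]_q) :
  moment_angle R (extend_complex q K) (row_mx z w) <->
  moment_angle R K z /\ torus R q w.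
Proof.
split=> [[_ /imsetP[s sK ->] [b1 b2]]|[[s sK [b1 b2]] w1]].
  split; last first.
    move=> a; have := b2 (rshift v a); rewrite row_mxEr; apply.
    by apply/imsetP => -[j _] /eqP; rewrite eq_rlshift.
  exists s => //; split=> j; first by have := b1 (lshift q j); rewrite row_mxEl.
  move=> js; have := b2 (lshift q j); rewrite row_mxEl; apply.
  by rewrite mem_imset //; exact: lshift_inj.
exists (lshift q @: s)%SET; first by apply/imsetP; exists s.
split=> k; case: (split_ordP k) => j ->; rewrite ?row_mxEl ?row_mxEr //.
- by rewrite w1.
- by rewrite mem_imset; [exact: b2|exact: lshift_inj].
Qed.

End ExtendComplex.

Section System.
Variables (R : realType) (v D : nat) (A : 'M[R]_(v, D)) (K : {set {set 'I_v}}).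
Hypothesis fanAK : complete_fan A K.
Notation m := (\rank (kermx A)).
Notation B := (relations A).

(** The n = 1 + (v + m) coordinates: a homogenizing one, the vertices of K, and the
    ghost vertices. *)
Definition hom_idx : 'I_(1 + (v + m)) := lshift (v + m) ord0.
Definition vertex_idx (j : 'I_v) : 'I_(1 + (v + m)) := rshift 1 (lshift m j).
Definition ghost_idx (a : 'I_m) : 'I_(1 + (v + m)) := rshift 1 (rshift v a).

Lemma index_ind (P : 'I_(1 + (v + m)) -> Prop) :
  P hom_idx -> (forall j, P (vertex_idx j)) -> (forall a, P (ghost_idx a)) ->
  forall k, P k.
Proof.
move=> Po Pv Pg k; case: (split_ordP k) => k' ->; first by rewrite ord1.
by case: (split_ordP k') => k'' ->; [exact: Pv|exact: Pg].
Qed.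

Lemma vertex_idx_inj : injective vertex_idx.
Proof. by move=> j j' /rshift_inj/lshift_inj. Qed.

Lemma hom_neq_vertex_idx j : hom_idx != vertex_idx j.
Proof. by rewrite /hom_idx /vertex_idx eq_lrshift. Qed.

Lemma ghost_neq_vertex_idx a j : ghost_idx a != vertex_idx j.
Proof. by rewrite /ghost_idx /vertex_idx (inj_eq (@rshift_inj _ _)) eq_rlshift. Qed.

(** The columns of B form a Gale dual of the rows of A.  The factor - i makes the real
    part of the bilinear form with T depend on Im T only at the vertices, so that the
    real part of T is free to normalize the ghost coordinates. *)
Definition lvmb_family (k : 'I_(1 + (v + m))) : 'rV[CC R]_m :=
  row k (col_mx 0 (col_mx (\matrix_(j, a) Complex 0 (- B a j)) 1%:M)).
Notation l := lvmb_family.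

Definition lvmb_sets : {set {set 'I_(1 + (v + m))}} :=
  [set ~: (vertex_idx @: s) | s : {set 'I_v} in [set s in K | #|s| == D]]%SET.

Lemma lvmb_family_o : l hom_idx = 0.
Proof. by rewrite /l rowKu row0. Qed.

Lemma lvmb_family_v j : l (vertex_idx j) = \row_a Complex 0 (- B a j).
Proof. by rewrite /l rowKd rowKu; apply/rowP => a; rewrite !mxE. Qed.

Lemma lvmb_family_g a : l (ghost_idx a) = delta_mx ord0 a.
Proof. by rewrite /l !rowKd row1. Qed.

Lemma bilinear_o T : bilinear_form (l hom_idx) T = 0.
Proof.
by rewrite /bilinear_form lvmb_family_o big1 // => a _; rewrite mxE mul0r.
Qed.

Lemma bilinear_g a T : bilinear_form (l (ghost_idx a)) T = T ord0 a.
Proof.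
rewrite /bilinear_form lvmb_family_g (bigD1 a) //= mxE !eqxx mul1r.
rewrite big1 ?addr0 // => b ba; rewrite mxE eqxx /= (negbTE ba).
by rewrite mul0r.
Qed.

Lemma Re_sum (I : finType) (F : I -> CC R) :
  complex.Re (\sum_i F i) = \sum_i complex.Re (F i).
Proof. exact: (big_morph (@complex.Re R) (fun x y => raddfD _ x y) erefl). Qed.

Lemma Im_sum (I : finType) (F : I -> CC R) :
  complex.Im (\sum_i F i) = \sum_i complex.Im (F i).
Proof. exact: (big_morph (@complex.Im R) (fun x y => raddfD _ x y) erefl). Qed.

Definition im_row (T : 'rV[CC R]_m) : 'rV[R]_m := map_mx (@complex.Im R) T.

Lemma Re_bilinear_v j T :
  complex.Re (bilinear_form (l (vertex_idx j)) T) = (im_row T *m B) ord0 j.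
Proof.
rewrite /bilinear_form lvmb_family_v Re_sum mxE; apply: eq_bigr => a _.
by rewrite !mxE; case: (T ord0 a) => x y /=; ring.
Qed.

Lemma bilinear_v_imaginary j (T : 'rV[CC R]_m) : (forall a, complex.Re (T ord0 a) = 0) ->
  bilinear_form (l (vertex_idx j)) T = ((im_row T *m B) ord0 j)%:C%C.
Proof.
move=> T0; apply/eqP; rewrite eq_complex Re_bilinear_v /= eqxx /=.
rewrite /bilinear_form lvmb_family_v Im_sum big1 // => a _.
by rewrite mxE; case: (T ord0 a) (T0 a) => x y /= ->; rewrite mulr0 mul0r addr0.
Qed.

(** Acceptable sets are the complements of the faces of K, by purity. *)
Lemma acceptableP (z : 'rV[CC R]_(1 + (v + m))) : acceptable_points lvmb_sets z <->
  [/\ z ord0 hom_idx != 0, forall a, z ord0 (ghost_idx a) != 0 &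
      [set j | z ord0 (vertex_idx j) == 0]%SET \in K].
Proof.
split=> [[Q /imsetP[s + ->] /fintype.subsetP sub] | [zo zg zK]].
  rewrite inE => /andP[sK _]; split.
  - have := sub hom_idx; rewrite !inE; apply; apply/imsetP => -[j _] /eqP.
    by rewrite (negbTE (hom_neq_vertex_idx j)).
  - move=> a; have := sub (ghost_idx a); rewrite !inE; apply; apply/imsetP => -[j _] /eqP.
    by rewrite (negbTE (ghost_neq_vertex_idx a j)).
  - apply: (face_sub fanAK sK); apply/fintype.subsetP => j; rewrite inE.
    apply: contraTT => js; have := sub (vertex_idx j); rewrite !inE; apply.
    by rewrite mem_imset //; exact: vertex_idx_inj.
have [t [tK zt] [ct _]] := facet_extends fanAK zK.
exists (~: (vertex_idx @: t))%SET.
  by apply/imsetP; exists t => //; rewrite inE tK ct eqxx.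
apply/fintype.subsetP; apply: index_ind => [||]; rewrite ?inE //.
  move=> j; rewrite !inE mem_imset; last exact: vertex_idx_inj.
  by apply: contra => zj; apply: (fintype.subsetP zt); rewrite inE.
by move=> a; rewrite !inE zg.
Qed.

Lemma lvmb_fundamental : fundamental_set m lvmb_sets.
Proof.
have [t [tK _] [ct _]] := facet_extends fanAK (face0 fanAK).
have mE : m = (v - D)%N by rewrite mxrank_ker (fan_rank fanAK).
have Dv : (D <= v)%N by rewrite -ct -[X in (_ <= X)%N]card_ord max_card.
split.
- by move: mE; set r := \rank _ => ->; lia.
- apply/finset.set0Pn; exists (~: (vertex_idx @: t))%SET.
  by apply/imsetP; exists t => //; rewrite inE tK ct eqxx.
- move=> _ /imsetP[s + ->]; rewrite inE => /andP[_ /eqP cs].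
  have := cardsC (vertex_idx @: s); rewrite card_imset ?cs ?card_ord; last first.
    exact: vertex_idx_inj.
  by move: mE; set r := \rank _; set c := #|_|; lia.
Qed.

(** The ghost vertices take care of the real parts.  For the imaginary parts, the
    columns of B outside a facet s span R^m by Gale duality: a combination of the
    rows of B that vanishes outside s is a relation supported on a face, hence 0. *)
Lemma lvmb_acceptable : acceptable_system lvmb_sets l.
Proof.
split=> [|_ /imsetP[s + ->]]; first exact: lvmb_fundamental.
rewrite inE => /andP[sK _] y.
pose S : 'M[R]_v := diag_mx (charv R (~: s)%SET).
have fr : row_free (B *m S).
  apply: inj_row_free => r; rewrite mulmxA => rBS.
  apply: (relations_inj (A := A)); apply: (face_independent fanAK sK).
    apply/csuppP => j js; move/rowP: rBS => /(_ j).
    by rewrite mul_mx_diag !mxE inE js mulr1.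
  exact: relationsA.
pose u := S *m pinvmx (B *m S) *m (- (im_row y)^T).
have Bu : B *m u = - (im_row y)^T by rewrite /u mulmxA mulmxA mulmxVp // mul1mx.
have us j : j \in s -> u j ord0 = 0.
  by move=> js; rewrite /u -mulmxA mul_diag_mx !mxE inE js mul0r.
pose c (k : 'I_(1 + (v + m))) : R :=
  col_mx (const_mx (1 - \sum_j u j ord0 - \sum_a complex.Re (y ord0 a)))
    (col_mx u (\col_a complex.Re (y ord0 a))) k ord0.
have co : c hom_idx = 1 - \sum_j u j ord0 - \sum_a complex.Re (y ord0 a).
  by rewrite /c col_mxEu mxE.
have cv j : c (vertex_idx j) = u j ord0 by rewrite /c col_mxEd col_mxEu.
have cg a : c (ghost_idx a) = complex.Re (y ord0 a) by rewrite /c !col_mxEd mxE.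
have notQ k : k \notin (~: (vertex_idx @: s))%SET -> c k = 0.
  by rewrite inE negbK => /imsetP[j js ->]; rewrite cv us.
have sumQ (V : zmodType) (F : 'I_(1 + (v + m)) -> V) :
    (forall k, c k = 0 -> F k = 0) ->
    \sum_(k in (~: (vertex_idx @: s))%SET) F k =
    F hom_idx + (\sum_j F (vertex_idx j) + \sum_a F (ghost_idx a)).
  move=> F0; rewrite -[RHS](_ : \sum_k F k = _); last first.
    by rewrite big_split_ord big_ord1 big_split_ord.
  rewrite [RHS](bigID (mem (~: (vertex_idx @: s))%SET)) /= [X in _ + X]big1 ?addr0 //.
  by move=> k /notQ/F0.
exists c; split.
  rewrite sumQ // co (eq_bigr _ (fun j _ => cv j)).
  by rewrite (eq_bigr (fun a => complex.Re (y ord0 a)) (fun a _ => cg a)); ring.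
rewrite sumQ; last by move=> k ->; rewrite scale0r.
rewrite lvmb_family_o scaler0 add0r.
apply/rowP => a; rewrite mxE !summxE.
rewrite [X in _ + X](bigD1 a) //= [X in _ + (_ + X)]big1 ?addr0; last first.
  by move=> b ba; rewrite lvmb_family_g !mxE /= [a == b]eq_sym (negbTE ba) mulr0.
rewrite lvmb_family_g !mxE !eqxx mulr1 cg.
have -> : \sum_i ((c (vertex_idx i))%:C%C *: l (vertex_idx i)) ord0 a =
    Complex 0 (complex.Im (y ord0 a)).
  have -> : complex.Im (y ord0 a) = - (B *m u) a ord0.
    by rewrite Bu !mxE opprK.
  apply/eqP; rewrite eq_complex Re_sum Im_sum /= big1 ?eqxx /=; last first.
    by move=> j _; rewrite lvmb_family_v !mxE /= mulr0 mul0r subr0.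
  apply/eqP; rewrite mxE -sumrN; apply: eq_bigr => j _.
  by rewrite lvmb_family_v mxE [(\row__ _) _ _]mxE cv /= mulr0 addr0 mulrN mulrC.
by case: (y ord0 a) => p q /=; rewrite /GRing.add /= add0r addr0.
Qed.

Definition hpoint (u : 'rV[CC R]_(v + m)) : 'rV[CC R]_(1 + (v + m)) :=
  row_mx (const_mx 1) u.

Lemma hpoint_o u : hpoint u ord0 hom_idx = 1.
Proof. by rewrite /hpoint row_mxEl mxE. Qed.

Lemma hpoint_v u j : hpoint u ord0 (vertex_idx j) = lsubmx u ord0 j.
Proof. by rewrite /hpoint row_mxEr mxE. Qed.

Lemma hpoint_g u a : hpoint u ord0 (ghost_idx a) = rsubmx u ord0 a.
Proof. by rewrite /hpoint row_mxEr mxE. Qed.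

Lemma hpoint_act u u' a T : hpoint u' = lvmb_act l a T (hpoint u) ->
  [/\ a = 1, forall b, rsubmx u' ord0 b = cexp (T ord0 b) * rsubmx u ord0 b &
   forall j, lsubmx u' ord0 j =
     cexp (bilinear_form (l (vertex_idx j)) T) * lsubmx u ord0 j].
Proof.
move=> /rowP e; have := e hom_idx; rewrite [RHS]mxE !hpoint_o bilinear_o cexp0 !mulr1.
move=> a1; split=> // [b|j].
  by have := e (ghost_idx b); rewrite [RHS]mxE !hpoint_g bilinear_g -a1 mul1r.
by have := e (vertex_idx j); rewrite [RHS]mxE !hpoint_v -a1 mul1r.
Qed.

Lemma flow_lvmb_act (T : 'rV[CC R]_m) (x : 'rV[CC R]_v) :
  (forall a, complex.Re (T ord0 a) = 0) ->
  flow (im_row T) x = \row_j (cexp (bilinear_form (l (vertex_idx j)) T) * x ord0 j).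
Proof.
by move=> T0; apply/rowP => j; rewrite !mxE bilinear_v_imaginary // cexp_real mxE.
Qed.

Notation Z := (moment_angle R (extend_complex m K)).

Lemma torus_cmod q (w : 'rV[CC R]_q) a : torus R q w -> cmod (w ord0 a) = 1.
Proof. by move=> /(_ a); rewrite cmodE; exact: (@complexI R _ 1). Qed.

(** Comparing the moduli of the ghost coordinates shows that T is imaginary, so that
    it acts on the other coordinates by the flow. *)
Lemma moment_angle_orbit u u' a T : Z u -> Z u' ->
  hpoint u' = lvmb_act l a T (hpoint u) -> u' = u.
Proof.
rewrite -[u]hsubmxK -[u']hsubmxK => /moment_angle_row_mx[Zx Zy].
move=> /moment_angle_row_mx[Zx' Zy']; rewrite !hsubmxK.
move=> /hpoint_act[_ eg ev].
have T0 b : complex.Re (T ord0 b) = 0.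
  have := congr1 (@cmod R) (eg b); rewrite cmodM cmod_cexp !torus_cmod // mulr1.
  by move/(congr1 (@ln R)); rewrite ln1 expRK.
have ex : lsubmx u' = flow (im_row T) (lsubmx u).
  by rewrite flow_lvmb_act //; apply/rowP => j; rewrite [RHS]mxE ev.
have t0 : im_row T = 0 by apply: (flow_unique fanAK Zx); rewrite -ex.
have {}T0 : T = 0.
  apply/rowP => b; rewrite mxE; apply/eqP; rewrite eq_complex T0 /= eqxx /=.
  by move/rowP: t0 => /(_ b); rewrite !mxE => ->.
rewrite -[u']hsubmxK -[u]hsubmxK; congr row_mx; first by rewrite ex t0 flow0.
by apply/rowP => b; rewrite eg T0 mxE cexp0 mul1r.
Qed.

Implicit Types z : 'rV[CC R]_(1 + (v + m)).

Definition xpart z : 'rV[CC R]_v := \row_j ((z ord0 hom_idx)^-1 * z ord0 (vertex_idx j)).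
Definition ypart z : 'rV[CC R]_m := \row_a ((z ord0 hom_idx)^-1 * z ord0 (ghost_idx a)).

(** The real part gives modulus 1 to the ghost coordinates, the imaginary part moves
    the vertex coordinates into the moment-angle complex of K. *)
Definition normal_time z : 'rV[CC R]_m :=
  \row_a Complex (- ln (cmod (ypart z ord0 a)))
                 (flow_time A K (xpart z) ord0 a).

Lemma im_row_normal_time z :
  im_row (normal_time z) = flow_time A K (xpart z).
Proof. by apply/rowP => b; rewrite mxE [normal_time z _ _]mxE. Qed.

Definition normal_form z : 'rV[CC R]_(v + m) :=
  row_mx (\row_j (cexp (bilinear_form (l (vertex_idx j)) (normal_time z)) *
                  xpart z ord0 j))
         (\row_a (cexp (normal_time z ord0 a) * ypart z ord0 a)).

Lemma hpoint_normal_form z : z ord0 hom_idx != 0 ->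
  hpoint (normal_form z) = lvmb_act l (z ord0 hom_idx)^-1 (normal_time z) z.
Proof.
move=> zo; apply/rowP; apply: index_ind => [|j|a]; rewrite [RHS]mxE.
- by rewrite hpoint_o bilinear_o cexp0 mulr1 mulVf.
- by rewrite hpoint_v /normal_form row_mxKl mxE [xpart z _ _]mxE; ring.
- by rewrite hpoint_g /normal_form row_mxKr mxE [ypart z _ _]mxE bilinear_g; ring.
Qed.

Lemma normal_form_in z : acceptable_points lvmb_sets z -> Z (normal_form z).
Proof.
move=> /acceptableP[zo zg zK]; apply/moment_angle_row_mx; split; last first.
  move=> a; rewrite cmodE mxE cmodM cmod_cexp [normal_time z _ _]mxE /=.
  have y0 : 0 < cmod (ypart z ord0 a).
    by rewrite cmod_gt0 mxE mulf_neq0 // invr_neq0.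
  by rewrite expRN lnK // mulVf // gt_eqF.
have xK : arrangement_compl K (xpart z).
  rewrite /arrangement_compl /=; move: zK; congr (_ \in K); apply/setP => j.
  by rewrite !inE mxE mulf_eq0 invr_eq0 (negbTE zo).
have cK : simplicial_complex K by case: fanAK.
set x' := \row_j _.
have e j : cmod (x' ord0 j) =
    cmod (flow (flow_time A K (xpart z)) (xpart z) ord0 j).
  by rewrite cmod_flow mxE cmodM cmod_cexp Re_bilinear_v im_row_normal_time.
have [h1 h2] := (iffLR (moment_angleP _ cK)) (flow_timeP fanAK xK).
apply/(moment_angleP _ cK); split=> [j|]; first by rewrite e.
by move: h2; congr (_ \in K); apply/setP => j; rewrite !inE e.
Qed.

End System.

(** * Subspaces, compactness and orbit spaces *)

Section Topology.

Lemma hausdorff_inj (X Y : topologicalType) (f : X -> Y) :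
  continuous f -> injective f -> hausdorff_space Y -> hausdorff_space X.
Proof.
move=> fc fi hY p q clpq; apply: fi; apply: hY => P Q Pp Qq.
by have [x [Px Qx]] := clpq _ _ (fc _ _ Pp) (fc _ _ Qq); exists (f x).
Qed.

Lemma val_continuous (X : topologicalType) (S : set X) :
  continuous (val : set_type S -> X).
Proof. exact: initial_continuous. Qed.

Lemma set_type_continuous (X Y : topologicalType) (S : set Y) (f : X -> set_type S) :
  continuous (val \o f) -> continuous f.
Proof. exact: continuous_comp_initial. Qed.

(** The inverse of the inclusion of S, made total by a default value. *)
Definition into (X : Type) (S : set X) (s0 : set_type S) (x : X) : set_type S :=
  if pselect (S x) is left h then exist _ x (mem_set h) else s0.

Lemma intoK (X : Type) (S : set X) (s0 : set_type S) x : S x -> val (into s0 x) = x.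
Proof. by rewrite /into; case: pselect. Qed.

Lemma into_val (X : Type) (S : set X) (s0 z : set_type S) : into s0 (val z) = z.
Proof. by apply: val_inj; apply: intoK; exact: set_valP. Qed.

Lemma into_continuous_at (X Y : topologicalType) (S : set Y) (s0 : set_type S)
    (f : X -> Y) x : {for x, continuous f} -> (\forall y \near x, S (f y)) ->
  {for x, continuous (into s0 \o f)}.
Proof.
move=> fc Sf U [_ [[W oW <-] /= Wf WU]].
have Sfx : S (f x) := nbhs_singleton Sf.
have {}Wf : W (f x) by rewrite -(intoK s0 Sfx).
have hW : \forall y \near x, W (f y) by apply: fc; exact: open_nbhs_nbhs.
apply: filterS2 hW Sf => y Wy Sy; apply: WU.
by suff : W (val (into s0 (f y))) by []; rewrite intoK.
Qed.

End Topology.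

Section ComplexCompactness.
Variable R : realType.

Lemma closed_cmod (P : set R) : closed P -> closed [set z : CC R | P (cmod z)].
Proof.
move=> cP; rewrite (_ : [set z | _] = @cmod R @^-1` P) //.
by apply: closed_comp => // z _; exact: cmod_continuous.
Qed.

Lemma compact_disk : compact [set z : CC R | cmod z <= 1].
Proof.
pose box : set (R * R) := `[(-1), 1]%classic `*` `[(-1), 1]%classic.
pose f (p : R * R) : CC R := Complex p.1 p.2.
have fc : continuous f.
  by move=> p; apply/(cvg_complexP (F := nbhs p)); split; [exact: cvg_fst|exact: cvg_snd].
apply: (@subclosed_compact _ _ (f @` box)).
- exact: (closed_cmod (@closed_le R 1)).
- apply: continuous_compact; first exact: continuous_subspaceT.
  by apply: compact_setX; exact: segment_compact.
- move=> z z1; exists (complex.Re z, complex.Im z); last by case: (z).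
  split => /=; rewrite in_itv /= -ler_norml (le_trans _ z1) //.
    exact: Re_le_cmod.
  exact: Im_le_cmod.
Qed.

Lemma compact_circle : compact [set z : CC R | cmod z = 1].
Proof.
apply: (subclosed_compact _ compact_disk) => [|z /= ->//].
exact: (closed_cmod (@closed_eq R 1)).
Qed.

Lemma compact_moment_angle n (K : {set {set 'I_n}}) : compact (moment_angle R K).
Proof.
have -> : moment_angle R K = \big[setU/set0]_(s <- enum K) polydisk_block s.
  rewrite -bigcup_seq.
  by apply/seteqP; split=> z [s sK zs]; exists s; rewrite //= ?mem_enum // -mem_enum.
apply: bigsetU_compact => s _.
have -> : polydisk_block s = [set z : 'rV[CC R]_n | forall i,
    (if i \in s then [set w : CC R | cmod w <= 1] else [set w : CC R | cmod w = 1])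
      (z ord0 i)].
  have le1 (w : CC R) : (`|w| <= 1) = (cmod w <= 1) by rewrite cmodE -lecR.
  have eq1 (w : CC R) : `|w| = 1 <-> cmod w = 1.
    by rewrite cmodE; split=> [|->//]; exact: (@complexI R _ 1).
  apply/seteqP; split=> z /= => [[z1 zs] i|zi].
    by case: ifPn => [_|/zs/eq1//] /=; rewrite -le1.
  split=> i; last by move=> iN; have := zi i; rewrite (negbTE iN) => /eq1.
  by have := zi i; rewrite le1; case: ifP => //= _ ->.
apply: (@rV_compact (CC R) n (fun i => if i \in s then [set w : CC R | cmod w <= 1]
  else [set w : CC R | cmod w = 1])) => i.
by case: ifP => _; [exact: compact_disk|exact: compact_circle].
Qed.

End ComplexCompactness.

Section OrbitSpaces.
Variables (R : realType) (m n : nat) (E : {set {set 'I_n}}) (l : 'I_n -> 'rV[CC R]_m).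

Lemma orbit_projP (z w : set_type (acceptable_points E)) :
  orbit_proj l z = orbit_proj l w <->
  exists (a : CC R) (T : 'rV[CC R]_m), a != 0 /\ val w = lvmb_act l a T (val z).
Proof.
split=> [/eqmodP/asboolP //|h].
by apply/eqmodP; apply/asboolP.
Qed.

Lemma orbit_proj_surj (q : orbit_space E l) : exists z, q = orbit_proj l z.
Proof. by exists (repr q); rewrite /orbit_proj reprK. Qed.

Lemma orbit_proj_continuous : continuous (orbit_proj l : set_type (acceptable_points E) -> _).
Proof. exact: pi_continuous. Qed.

Lemma orbit_openP (U : set (orbit_space E l)) : open U <-> open (orbit_proj l @^-1` U).
Proof. by []. Qed.

Lemma orbit_lift_continuous (Z : topologicalType) (f : orbit_space E l -> Z) :
  continuous (f \o orbit_proj l) -> continuous f.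
Proof. by move=> fc; apply/quotient_continuous. Qed.

(** Acceptability only asks for enough nonzero coordinates. *)
Lemma open_acceptable_points : open (acceptable_points E : set 'rV[CC R]_n).
Proof.
rewrite openE => z [Q QE /fintype.subsetP Qz].
have : \forall w \near z, forall k, k \in Q -> (w : 'rV[CC R]_n) ord0 k != 0.
  apply: (filter_forall (nbhs_filter z)) => k.
  have [kQ|kN] := boolP (k \in Q); last by near=> w.
  have zk : z ord0 k != 0 by have := Qz k kQ; rewrite inE.
  have := @coord_continuous (CC R) _ _ ord0 k z.
  by move=> /cvgr_neq0/(_ zk); apply: filterS.
apply: filterS => w wQ; exists Q => //; apply/fintype.subsetP => k kQ.
by rewrite inE wQ.
Unshelve. all: by end_near.
Qed.

End OrbitSpaces.

(** * The orbit space as a moment-angle complex *)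

Section MomentAngleOrbits.
Variables (R : realType) (v D : nat) (A : 'M[R]_(v, D)) (K : {set {set 'I_v}}).
Hypothesis fanAK : complete_fan A K.
Notation m := (\rank (kermx A)).
Notation B := (relations A).
Notation l := (@lvmb_family R v D A).
Notation E := (lvmb_sets A K).
Notation Z := (moment_angle R (extend_complex m K)).
Notation S := (@acceptable_points R (1 + (v + m)) E).
Notation N := (orbit_space E l).
Implicit Types (u : 'rV[CC R]_(v + m)) (z : 'rV[CC R]_(1 + (v + m))).

Lemma hpoint_acceptable u : S (hpoint (A := A) u) <->
  arrangement_compl K (lsubmx u) /\ forall a, rsubmx u ord0 a != 0.
Proof.
have zs : [set j | hpoint (A := A) u ord0 (vertex_idx A j) == 0]%SET = zero_set (lsubmx u).
  by apply/setP => j; rewrite !inE hpoint_v.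
split=> [/(acceptableP fanAK)[_ ug uK]|[uK ug]].
  by split=> [|a]; [rewrite /arrangement_compl /= -zs|rewrite -hpoint_g].
by apply/(acceptableP fanAK); split; rewrite ?zs ?hpoint_o ?oner_eq0 // => a; rewrite hpoint_g.
Qed.

Lemma moment_angle_acceptable u : Z u -> S (hpoint (A := A) u).
Proof.
rewrite -{1}[u]hsubmxK => /moment_angle_row_mx[Zx Zy]; apply/hpoint_acceptable.
split=> [|a]; first by apply: moment_angle_compl Zx; case: fanAK.
by rewrite -cmod_gt0 (torus_cmod _ Zy) ltr01.
Qed.

Lemma acceptable1 : S (hpoint (A := A) (const_mx 1)).
Proof.
apply/hpoint_acceptable; split=> [|a]; last by rewrite !mxE oner_eq0.
rewrite /arrangement_compl /=.
suff -> : zero_set (lsubmx (const_mx (1 : CC R) : 'rV_(v + m))) = finset.set0.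
  exact: face0 fanAK.
by apply/setP => j; rewrite !inE !mxE oner_eq0.
Qed.

Definition base_point : set_type S :=
  exist (fun z => z \in S) _ (mem_set acceptable1).

Definition hclass u : N := orbit_proj l (into base_point (hpoint (A := A) u)).

Lemma hclassP u u' : S (hpoint (A := A) u) -> S (hpoint (A := A) u') ->
  hclass u = hclass u' <-> exists (a : CC R) (T : 'rV[CC R]_m),
    a != 0 /\ hpoint (A := A) u' = lvmb_act l a T (hpoint u).
Proof.
move=> Su Su'; split=> [/orbit_projP|h]; first by rewrite !intoK.
by apply/orbit_projP; rewrite !intoK.
Qed.

Lemma hpoint_continuous : continuous (@hpoint R v D A).
Proof.
move=> u; apply: (cvg_mx (F := nbhs u)) => i k; rewrite ord1.
elim/index_ind: k => [|j|a].
- by rewrite hpoint_o; under eq_fun do rewrite hpoint_o; exact: (@cvg_cst _ _ _ (nbhs u)).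
- rewrite hpoint_v mxE; under eq_fun do rewrite hpoint_v mxE.
  exact: coord_continuous.
- rewrite hpoint_g mxE; under eq_fun do rewrite hpoint_g mxE.
  exact: coord_continuous.
Qed.

Lemma hclass_continuous_at u : S (hpoint (A := A) u) -> {for u, continuous hclass}.
Proof.
move=> Su; apply: (@continuous_comp _ _ _ (into base_point \o @hpoint R v D A)
  (orbit_proj l)); last exact: orbit_proj_continuous.
apply: into_continuous_at; first exact: hpoint_continuous.
apply: hpoint_continuous; apply: open_nbhs_nbhs; split=> //.
exact: open_acceptable_points.
Qed.

Lemma hclass_normal_form z : S z ->
  hclass (normal_form K z) = orbit_proj l (into base_point z).
Proof.
move=> Sz; have [zo _ _] := (iffLR (acceptableP fanAK z)) Sz.
apply/esym/orbit_projP; rewrite !intoK //; last first.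
  by apply: moment_angle_acceptable; exact: normal_form_in.
exists (z ord0 (hom_idx A))^-1, (normal_time K z).
by rewrite invr_neq0 // hpoint_normal_form.
Qed.

(** Two normal forms in the same orbit are equal by [moment_angle_orbit]. *)
Lemma normal_form_orbit z w a (T : 'rV[CC R]_m) : S z -> S w -> a != 0 ->
  w = lvmb_act l a T z -> normal_form K w = normal_form K z.
Proof.
move=> Sz Sw a0 e.
have [zo _ _] := (iffLR (acceptableP fanAK z)) Sz.
have [wo _ _] := (iffLR (acceptableP fanAK w)) Sw.
apply: (moment_angle_orbit fanAK
  (a := (w ord0 (hom_idx A))^-1 * (a * z ord0 (hom_idx A)))
  (T := normal_time K w + (T - normal_time K z))); [exact: normal_form_in..|].
rewrite hpoint_normal_form // hpoint_normal_form // lvmb_actM.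
rewrite -!mulrA mulfV // mulr1 -addrA subrK e lvmb_actM.
by [].
Qed.

Lemma normal_form_hpoint u : Z u -> normal_form K (hpoint (A := A) u) = u.
Proof.
move=> Zu; have Su := moment_angle_acceptable Zu.
apply: (moment_angle_orbit fanAK Zu (normal_form_in fanAK Su)).
by rewrite hpoint_normal_form // hpoint_o oner_eq0.
Qed.

Lemma normal_form_continuous_at z : S z ->
  {for z, continuous (@normal_form R v D A K)}.
Proof.
move=> Sz; have [zo zg zK] := (iffLR (acceptableP fanAK z)) Sz.
have coordc k : (fun z : 'rV[CC R]_(1 + (v + m)) => z ord0 k) @ z --> z ord0 k.
  exact: coord_continuous.
have ioc : (fun z : 'rV[CC R]_(1 + (v + m)) => (z ord0 (hom_idx A))^-1) @ z -->
    (z ord0 (hom_idx A))^-1.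
  exact: (cvgV zo (coordc _)).
have xc : {for z, continuous (@xpart R v D A)}.
  apply: (cvg_mx (F := nbhs z)) => i j; rewrite mxE; under eq_fun do rewrite mxE.
  exact: (cvgM ioc (coordc _)).
have ycb a : (fun z => ypart z ord0 a) @ z --> ypart z ord0 a.
  rewrite mxE; under eq_fun do rewrite mxE.
  exact: (cvgM ioc (coordc _)).
have xK : arrangement_compl K (xpart z).
  rewrite /arrangement_compl /=; move: zK; congr (_ \in K); apply/setP => j.
  by rewrite !inE mxE mulf_eq0 invr_eq0 (negbTE zo).
have tc : {for z, continuous (flow_time A K \o @xpart R v D A)}.
  by apply: continuous_comp => //; exact: flow_time_continuous.
have ntc a : (fun z => normal_time K z ord0 a) @ z --> normal_time K z ord0 a.
  rewrite mxE; under eq_fun do rewrite mxE.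
  apply/(cvg_complexP (F := nbhs z)); split=> /=; last first.
    exact: (cvg_coord (F := nbhs z) tc).
  apply: (cvgN (F := nbhs z)).
  have yN : 0 < cmod (ypart z ord0 a).
    by rewrite cmod_gt0 mxE mulf_neq0 // invr_neq0.
  have cyc : (fun z => cmod (ypart z ord0 a)) @ z --> cmod (ypart z ord0 a).
    exact: (@cvg_comp _ _ _ (fun z => ypart z ord0 a) (@cmod R) _ _ _ (ycb a)
      (@cmod_continuous R _)).
  exact: (@cvg_comp _ _ _ (fun z => cmod (ypart z ord0 a)) (@ln R) _ _ _ cyc
      (continuous_ln yN)).
have expc (f : 'rV[CC R]_(1 + (v + m)) -> CC R) :
    f @ z --> f z -> (fun z => cexp (f z)) @ z --> cexp (f z).
  move=> fc; exact: (@cvg_comp _ _ _ f (@cexp R) _ _ _ fc (@cexp_continuous R _)).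
have bc k : (fun z => bilinear_form (l k) (normal_time K z)) @ z -->
    bilinear_form (l k) (normal_time K z).
  apply: (cvg_sum_ord (F := nbhs z)) => a.
  exact: (cvgM (@cvg_cst _ _ _ (nbhs z) _) (ntc a)).
apply: (cvg_mx (F := nbhs z)) => i k; rewrite ord1.
case: (split_ordP k) => j ->.
  rewrite row_mxEl mxE; under eq_fun do rewrite row_mxEl mxE.
  have h2 : (fun z => xpart z ord0 j) @ z --> xpart z ord0 j.
    apply: (@cvg_coord (CC R) _ (nbhs z) _ 1 v (@xpart R v D A) (xpart z) ord0 j).
    exact: xc.
  exact: (cvgM (expc _ (bc (vertex_idx A j))) h2).
rewrite row_mxEr mxE; under eq_fun do rewrite row_mxEr mxE.
exact: (cvgM (expc _ (ntc _)) (ycb _)).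
Qed.

(** The representative of an orbit in the moment-angle complex; it is continuous
    because the normal form is continuous and constant on orbits. *)
Definition orbit_form (q : N) : 'rV[CC R]_(v + m) := normal_form K (val (repr q)).

Lemma orbit_form_proj (z : set_type S) : orbit_form (orbit_proj l z) = normal_form K (val z).
Proof.
rewrite /orbit_form; set w := repr _.
have /orbit_projP[a [T [a0 e]]] : orbit_proj l z = orbit_proj l w.
  by rewrite /w /orbit_proj reprK.
by apply: (normal_form_orbit _ _ a0 e); exact: set_valP.
Qed.

Lemma orbit_form_in q : Z (orbit_form q).
Proof. by apply: (normal_form_in fanAK); exact: set_valP. Qed.

Lemma orbit_formK q : hclass (orbit_form q) = q.
Proof.
have [z ->] := orbit_proj_surj q.
rewrite orbit_form_proj hclass_normal_form ?into_val //; exact: set_valP.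
Qed.

Lemma hclassK u : Z u -> orbit_form (hclass u) = u.
Proof.
move=> Zu; rewrite orbit_form_proj intoK ?normal_form_hpoint //.
exact: moment_angle_acceptable.
Qed.

Lemma orbit_form_continuous : continuous orbit_form.
Proof.
apply: orbit_lift_continuous => z.
have -> : orbit_form \o orbit_proj l = @normal_form R v D A K \o val.
  by apply/funext => w /=; rewrite orbit_form_proj.
apply: continuous_comp; first exact: val_continuous.
by apply: normal_form_continuous_at; exact: set_valP.
Qed.

Lemma orbit_space_hausdorff : hausdorff_space N.
Proof.
apply: (hausdorff_inj orbit_form_continuous); first exact: can_inj orbit_formK.
exact: norm_hausdorff.
Qed.

Lemma orbit_space_compact : compact [set: N].
Proof.
rewrite (_ : [set: N] = hclass @` Z); last first.
  apply/seteqP; split=> // q _.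
  by exists (orbit_form q); [exact: orbit_form_in|exact: orbit_formK].
apply: continuous_compact; last exact: compact_moment_angle.
apply: continuous_in_subspaceT => u; rewrite inE => Zu.
by apply: hclass_continuous_at; exact: moment_angle_acceptable.
Qed.

Definition moment_angle_class (u : set_type Z) : N := hclass (val u).

Definition class_moment_angle (q : N) : set_type Z :=
  exist (fun u => u \in Z) _ (mem_set (orbit_form_in q)).

Lemma moment_angle_classK : cancel moment_angle_class class_moment_angle.
Proof. by move=> u; apply: val_inj; apply: hclassK; exact: set_valP. Qed.

Lemma class_moment_angleK : cancel class_moment_angle moment_angle_class.
Proof. exact: orbit_formK. Qed.

Lemma moment_angle_class_continuous : continuous moment_angle_class.
Proof.
move=> u; apply: continuous_comp; first exact: val_continuous.
by apply: hclass_continuous_at; apply: moment_angle_acceptable; exact: set_valP.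
Qed.

Lemma class_moment_angle_continuous : continuous class_moment_angle.
Proof. by apply: set_type_continuous; exact: orbit_form_continuous. Qed.

End MomentAngleOrbits.

(** * Differentiability, and surjectivity of the exponential *)

Section Differentiability.
Variables (F : numFieldType) (V W : normedModType F).

Lemma differentiable_near (f g : V -> W) x :
  (\forall y \near x, f y = g y) -> differentiable f x -> differentiable g x.
Proof.
move=> fg /diff_locallyP[dfc df].
have fgx : f x = g x := nbhs_singleton fg.
have dg : g \o shift x = cst (g x) + 'd f x +o_ 0 id.
  apply/eqaddoP => e e0; have /eqaddoP/(_ e e0) h := df.
  have fg0 : \forall h \near (0 : V), f (h + x) = g (h + x).
    by move: fg; rewrite (near_shift 0) /= subr0.
  by apply: filterS2 h fg0 => h; rewrite /= /cst !fctE /= fgx => + <-.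
by apply/diff_locallyP; rewrite (diff_unique dfc dg).
Qed.

End Differentiability.

Section RowDifferentiability.
Variables (F : numFieldType) (V : normedModType F).

Lemma differentiable_row n (f : V -> 'rV[F]_n) x :
  (forall j, differentiable (fun y => f y ord0 j) x) -> differentiable f x.
Proof.
move=> df; have -> : f = \sum_(j < n) (fun y => f y ord0 j *: (delta_mx ord0 j : 'rV[F]_n)).
  apply/funext => y; rewrite fct_sumE; exact: row_sum_delta.
by apply: differentiable_sum => j; exact: differentiableZl.
Qed.

End RowDifferentiability.

Section ComplexSurjectivity.
Variable R : realType.

(** Multiplication by i or by -1, which are exponentials, moves any nonzero number
    into the domain of [clogK]. *)
Lemma cexp_surj (w : CC R) : w != 0 -> exists z, cexp z = w.
Proof.
have pos (w' : CC R) : 0 < complex.Re w' -> exists z, cexp z = w'.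
  by move=> h; exists (clog w'); exact: clogK.
have rot (b : R) (w' : CC R) : (exists z, cexp z = w') ->
    exists z, cexp z = cexp (Complex 0 b) * w'.
  by move=> [z <-]; exists (Complex 0 b + z); rewrite cexpD.
have half (w' : CC R) : complex.Re w' != 0 -> exists z, cexp z = w'.
  move=> wN; have [h|h|h] := ltgtP (complex.Re w') 0; last by rewrite h eqxx in wN.
    have -> : w' = cexp (Complex 0 (trigo.pi : R)) * - w'.
      case: w' {wN h} => a b; apply/eqP; rewrite /cexp /= expR0 cospi sinpi.
      by rewrite eq_complex /=; apply/andP; split; apply/eqP; ring.
    by apply: rot; apply: pos; case: w' wN h => a b /= _; rewrite oppr_gt0.
  exact: pos.
move=> w0; have [h|] := eqVneq (complex.Re w) 0; last exact: half.
have -> : w = cexp (Complex 0 (trigo.pi / 2 : R)) * Complex (complex.Im w) (- complex.Re w).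
  case: w {w0 h} => a b; apply/eqP; rewrite /cexp /= expR0 cos_pihalf sin_pihalf.
  by rewrite eq_complex /=; apply/andP; split; apply/eqP; ring.
apply: rot; apply: half => /=; apply: contraNneq w0 => h'.
by rewrite eq_complex h h' /= !eqxx.
Qed.

End ComplexSurjectivity.

(** * The slice where all ghost coordinates are 1 *)

Section Slice.
Variables (R : realType) (v D : nat) (A : 'M[R]_(v, D)) (K : {set {set 'I_v}}).
Hypothesis fanAK : complete_fan A K.
Notation m := (\rank (kermx A)).
Notation l := (@lvmb_family R v D A).
Notation E := (lvmb_sets A K).
Notation S := (@acceptable_points R (1 + (v + m)) E).
Notation N := (orbit_space E l).
Notation U := (@arrangement_compl R v K).
Notation base := (base_point fanAK).
Implicit Types (x : 'rV[CC R]_v) (z : 'rV[CC R]_(1 + (v + m))).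

Definition slice_point x : 'rV[CC R]_(v + m) := row_mx x (const_mx 1).

Definition slice_class x : N := hclass fanAK (slice_point x).
Notation p := slice_class.

Lemma slice_acceptable x : U x -> S (hpoint (A := A) (slice_point x)).
Proof.
move=> xU; apply/(hpoint_acceptable fanAK); rewrite row_mxKl row_mxKr; split=> // a.
by rewrite mxE oner_eq0.
Qed.

Lemma slice_class_continuous_at x : U x -> {for x, continuous p}.
Proof.
move=> xU; apply: (@continuous_comp _ _ _ slice_point (hclass fanAK)); last first.
  exact/hclass_continuous_at/slice_acceptable.
apply: (cvg_mx (F := nbhs x)) => i k; rewrite ord1.
case: (split_ordP k) => j ->.
  rewrite row_mxEl; under eq_fun do rewrite row_mxEl; exact: coord_continuous.
rewrite row_mxEr; under eq_fun do rewrite row_mxEr.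
exact: (@cvg_cst _ _ _ (nbhs x)).
Qed.

(** The elements of the group that preserve the slice act on it by the flow at times
    in 2 pi Z^m. *)
Lemma slice_class_eq x x' : U x -> U x' -> p x = p x' ->
  exists2 t : 'rV[R]_m, forall a, cexp (Complex 0 (t ord0 a)) = 1 & x' = flow t x.
Proof.
move=> xU x'U /(hclassP fanAK (slice_acceptable xU) (slice_acceptable x'U))[a [T [_]]].
move=> /hpoint_act[_ eg ev].
have eT b : cexp (T ord0 b) = 1 by have := eg b; rewrite !row_mxKr !mxE mulr1.
have T0 b : complex.Re (T ord0 b) = 0.
  apply: (@expR_inj R); rewrite -cmod_cexp eT expR0; exact: (@cmod_real _ 1).
exists (im_row T) => [b|].
  by rewrite mxE -[RHS](eT b); congr cexp; case: (T ord0 b) (T0 b) => ? ? /= ->.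
rewrite flow_lvmb_act //; apply/rowP => j.
by rewrite [RHS]mxE; have := ev j; rewrite !row_mxKl.
Qed.

Lemma flow_compl (t : 'rV[R]_m) x : U x -> U (flow (A := A) t x).
Proof. by rewrite /arrangement_compl /= zero_set_flow. Qed.

Lemma slice_class_flow (t : 'rV[R]_m) x : U x ->
  (forall a, cexp (Complex 0 (t ord0 a)) = 1) -> p (flow (A := A) t x) = p x.
Proof.
move=> xU t1; have yU := flow_compl t xU.
apply/esym/(hclassP fanAK (slice_acceptable xU) (slice_acceptable yU)).
pose T : 'rV[CC R]_m := \row_a Complex 0 (t ord0 a).
have T0 a : complex.Re (T ord0 a) = 0 by rewrite mxE.
have Tt : im_row T = t by apply/rowP => a; rewrite !mxE.
exists 1, T; split; first exact: oner_neq0.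
apply/rowP; apply: index_ind => [|j|a]; rewrite [RHS]mxE mul1r.
- by rewrite !hpoint_o bilinear_o cexp0 mulr1.
- by rewrite !hpoint_v !row_mxKl -{1}Tt flow_lvmb_act // mxE.
- by rewrite !hpoint_g !row_mxKr !mxE bilinear_g [T _ _]mxE t1 mulr1.
Qed.

(** The result of acting by T on z, after normalization of the homogenizing
    coordinate; it lies in the slice when T brings the ghost coordinates to 1. *)
Definition to_slice (T : 'rV[CC R]_m) z : 'rV[CC R]_v :=
  \row_j (cexp (bilinear_form (l (vertex_idx A j)) T) * xpart z ord0 j).

Lemma to_sliceP (T : 'rV[CC R]_m) z : S z ->
  (forall a, cexp (T ord0 a) * ypart z ord0 a = 1) ->
  U (to_slice T z) /\ p (to_slice T z) = orbit_proj l (into base z).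
Proof.
move=> Sz Ty; have [zo zg zK] := (iffLR (acceptableP fanAK z)) Sz.
have xU : U (to_slice T z).
  rewrite /arrangement_compl /=; move: zK; congr (_ \in K); apply/setP => j.
  by rewrite !inE mxE mulf_eq0 (negbTE (cexp_neq0 _)) mxE mulf_eq0 invr_eq0 (negbTE zo).
split=> //; apply/esym/orbit_projP.
exists (z ord0 (hom_idx A))^-1, T; rewrite invr_neq0 //; split=> //.
rewrite !intoK //; last exact: slice_acceptable.
apply/rowP; apply: index_ind => [|j|a]; rewrite [RHS]mxE.
- by rewrite hpoint_o bilinear_o cexp0 mulr1 mulVf.
- by rewrite hpoint_v row_mxKl mxE [xpart z _ _]mxE; ring.
- rewrite hpoint_g row_mxKr mxE bilinear_g -[LHS](Ty a).
  by rewrite [ypart z _ _]mxE; ring.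
Qed.

Lemma to_slice_eq (T : 'rV[CC R]_m) z x : S z -> U x ->
  hpoint (slice_point x) = lvmb_act l (z ord0 (hom_idx A))^-1 T z ->
  (forall a, cexp (T ord0 a) * ypart z ord0 a = 1) /\ x = to_slice T z.
Proof.
move=> Sz xU /rowP e; split=> [a|].
  have := e (ghost_idx a); rewrite hpoint_g row_mxKr mxE [RHS]mxE bilinear_g => ->.
  by rewrite mxE; ring.
apply/rowP => j; have := e (vertex_idx A j); rewrite hpoint_v row_mxKl [RHS]mxE => ->.
by rewrite mxE [xpart z _ _]mxE; ring.
Qed.

Lemma slice_class_surj (q : N) : exists2 x, U x & p x = q.
Proof.
have [w ->] := orbit_proj_surj q; pose z := val w; have Sz : S z := set_valP w.
have [zo zg zK] := (iffLR (acceptableP fanAK z)) Sz.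
have h a : exists t, cexp t = (ypart z ord0 a)^-1.
  by apply: cexp_surj; rewrite invr_neq0 // mxE mulf_neq0 // invr_neq0.
pose T : 'rV[CC R]_m := \row_a xget 0 [set t | cexp t = (ypart z ord0 a)^-1].
have [xU xp] : U (to_slice T z) /\ p (to_slice T z) = orbit_proj l (into base z).
  apply: to_sliceP => // a; rewrite mxE (xgetPex 0 (h a)) mulVf // mxE mulf_neq0 //.
  by rewrite invr_neq0.
by exists (to_slice T z) => //; rewrite xp into_val.
Qed.

(** The vector that brings the ghost coordinates of z1 to 1 is corrected at z by the
    logarithms of the ratios between the ghost coordinates of z and those of z1;
    these ratios are near 1, where the principal branch is holomorphic. *)
Lemma slice_lift z1 x1 : S z1 -> U x1 -> p x1 = orbit_proj l (into base z1) ->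
  exists X : 'rV[CC R]_(1 + (v + m)) -> 'rV[CC R]_v,
    [/\ X z1 = x1, differentiable X z1 &
     \forall z \near z1, S z -> U (X z) /\ p (X z) = orbit_proj l (into base z)].
Proof.
move=> Sz xU /esym/orbit_projP[a [T [a0]]].
rewrite !intoK //; last exact: slice_acceptable.
move=> e; have [zo zg zK] := (iffLR (acceptableP fanAK z1)) Sz.
have a1 : a = (z1 ord0 (hom_idx A))^-1.
  move/rowP: e => /(_ (hom_idx A)); rewrite hpoint_o mxE bilinear_o cexp0 mulr1.
  by move=> h; apply: (mulIf zo); rewrite -h mulVf.
rewrite a1 in e; have [Ty x1E] := to_slice_eq Sz xU e.
have y1N b : ypart z1 ord0 b != 0 by rewrite mxE mulf_neq0 // invr_neq0.
pose r b z : CC R := ypart z ord0 b / ypart z1 ord0 b.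
pose T' z : 'rV[CC R]_m := \row_b (T ord0 b - clog (r b z)).
have r1 b : r b z1 = 1 by rewrite /r mulfV.
have coordd k : differentiable (fun z : 'rV[CC R]_(1 + (v + m)) => z ord0 k) z1.
  exact: differentiable_coord.
have iod : differentiable (fun z : 'rV[CC R]_(1 + (v + m)) => (z ord0 (hom_idx A))^-1) z1.
  exact: (differentiableV (coordd _) zo).
have rd b : differentiable (r b) z1.
  have -> : r b = (fun z => (z ord0 (hom_idx A))^-1) * (fun z => z ord0 (ghost_idx b)) *
      cst ((ypart z1 ord0 b)^-1).
    by apply/funext => z; rewrite /r [ypart z _ _]mxE.
  apply: differentiableM; last exact: differentiable_cst.
  exact: (differentiableM iod (coordd _)).
have Td b : differentiable (fun z => T' z ord0 b) z1.
  have -> : (fun z => T' z ord0 b) = cst (T ord0 b) - (@clog R \o r b).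
    by apply/funext => z; rewrite mxE.
  apply: differentiableB; first exact: differentiable_cst.
  by apply: differentiable_comp => //; rewrite r1; exact: clog_differentiable1.
have bd k : differentiable (fun z => bilinear_form (l k) (T' z)) z1.
  have -> : (fun z => bilinear_form (l k) (T' z)) =
      \sum_(b < m) (cst (l k ord0 b) * (fun z => T' z ord0 b)).
    by apply/funext => z; rewrite fct_sumE.
  apply: differentiable_sum => b.
  by apply: differentiableM => //; exact: differentiable_cst.
exists (fun z => to_slice (T' z) z); split.
- rewrite x1E; congr (to_slice _ _); apply/rowP => b.
  by rewrite mxE r1 clog1 subr0.
- apply: differentiable_row => j.
  have -> : (fun z => to_slice (T' z) z ord0 j) =
      (@cexp R \o (fun z => bilinear_form (l (vertex_idx A j)) (T' z))) *
      ((fun z => (z ord0 (hom_idx A))^-1) * (fun z => z ord0 (vertex_idx A j))).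
    by apply/funext => z; rewrite mxE [xpart z _ _]mxE.
  apply: differentiableM; last exact: (differentiableM iod (coordd _)).
  apply: differentiable_comp; first exact: bd.
  exact: cexp_differentiable.
have rnear : \forall z \near z1, forall b, cexp (clog (r b z)) = r b z.
  apply: (filter_forall (nbhs_filter z1)) => b.
  have rc : r b z @[z --> z1] --> r b z1 := differentiable_continuous (rd b).
  by rewrite r1 in rc; exact: rc (@clogK_near1 R).
apply: filterS rnear => z rz Sz'; apply: to_sliceP => // b.
rewrite mxE cexpD cexpN rz -(Ty b) /r invf_div.
have [zo' zg' _] := (iffLR (acceptableP fanAK z)) Sz'.
have yN : ypart z ord0 b != 0 by rewrite mxE mulf_neq0 // invr_neq0.
by rewrite -mulrA divfK.
Qed.

End Slice.

(** * Complex atlas of the orbit space *)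

Section Atlas.
Variables (R : realType) (v D : nat) (A : 'M[R]_(v, D)) (K : {set {set 'I_v}}).
Hypothesis fanAK : complete_fan A K.
Notation m := (\rank (kermx A)).
Notation l := (@lvmb_family R v D A).
Notation E := (lvmb_sets A K).
Notation S := (@acceptable_points R (1 + (v + m)) E).
Notation N := (orbit_space E l).
Notation U := (@arrangement_compl R v K).
Notation base := (base_point fanAK).
Notation p := (slice_class fanAK).
Implicit Types (x : 'rV[CC R]_v) (z : 'rV[CC R]_(1 + (v + m))) (W : set 'rV[CC R]_v).

(** The domains of the local inverses of the quotient map p. *)
Definition slice_domain W : Prop :=
  [/\ open W, W `<=` U & forall x x', W x -> W x' -> p x = p x' -> x = x'].

Definition slice_chart W : chart R N v :=
  Chart (p @` W) (fun q => xget 0 [set x | W x /\ p x = q]) p.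

Definition slice_atlas : set (chart R N v) :=
  [set c | exists2 W, slice_domain W & c = slice_chart W].

Lemma slice_chartK W x : slice_domain W -> W x -> chart_map (slice_chart W) (p x) = x.
Proof.
by move=> [_ _ inj] Wx; apply: xget_unique => //= y [Wy]; exact: inj.
Qed.

(** By continuity, the lift of [slice_lift] stays in an open set W near z1. *)
Lemma near_lift (z1 : set_type S) x1 W : open W -> W `<=` U -> W x1 ->
  p x1 = orbit_proj l z1 ->
  exists X : 'rV[CC R]_(1 + (v + m)) -> 'rV[CC R]_v,
    [/\ X (val z1) = x1, differentiable X (val z1) &
     \forall z \near val z1,
       S z /\ W (X z) /\ p (X z) = orbit_proj l (into base z)].
Proof.
move=> oW WU Wx e; rewrite -(into_val base z1) in e.
have [X [Xz dX hX]] := slice_lift (set_valP z1) (WU _ Wx) e.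
exists X; split=> //.
have Xc : X z @[z --> val z1] --> X (val z1) := differentiable_continuous dX.
rewrite Xz in Xc.
have nW : \forall z \near val z1, W (X z) by apply: Xc; exact: open_nbhs_nbhs.
have nS : \forall z \near val z1, S z.
  by apply: open_nbhs_nbhs; split; [exact: open_acceptable_points|exact: set_valP].
by apply: filterS3 hX nW nS => z h1 h2 /[dup] h3 /h1[_ h4].
Qed.

(** The acceptable points whose orbit meets W are an open set, because [near_lift]
    moves the points near one of them into W. *)
Lemma slice_class_open W : open W -> W `<=` U -> open (p @` W).
Proof.
move=> oW WU; apply/orbit_openP; rewrite openE => z1 [x1 Wx e].
have [X [_ _ hX]] := near_lift oW WU Wx e.
have : \forall z \near z1, S (val z) /\ W (X (val z)) /\
    p (X (val z)) = orbit_proj l (into base (val z)) by exact: val_continuous hX.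
by apply: filterS => z [_ [h1 h2]]; exists (X (val z)) => //; rewrite h2 into_val.
Qed.

Lemma slice_chart_image W (Q : set N) : slice_domain W ->
  chart_map (slice_chart W) @` (p @` W `&` Q) = W `&` p @^-1` Q.
Proof.
move=> gW; apply/seteqP; split=> [_ [_ [[x Wx <-] Qx] <-]|x [Wx Qx]].
  by rewrite slice_chartK.
by exists (p x); [split=> //; exists x|exact: slice_chartK].
Qed.

Lemma slice_chart_is_chart W : slice_domain W -> is_chart (slice_chart W).
Proof.
move=> gW; have [oW WU inj] := gW.
have img : chart_map (slice_chart W) @` (p @` W) = W.
  by rewrite -[p @` W]setIT slice_chart_image // preimage_setT setIT.
split; rewrite ?img //.
- exact: slice_class_open.
- apply/subspace_continuousP => _ [x Wx <-] O.
  move=> hO; have xO : nbhs x O by rewrite -(slice_chartK gW Wx).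
  have [Q [oQ Qx] QO] : exists2 Q, open_nbhs x Q & Q `<=` O.
    by move: xO; rewrite nbhsE.
  have : \forall q \near p x, (p @` (W `&` Q)) q.
    apply: open_nbhs_nbhs; split; last by exists x.
    by apply: slice_class_open; [exact: openI|move=> y [/WU]].
  apply: filterS => _ [y [Wy Qy] <-] _.
  suff : O (chart_map (slice_chart W) (p y)) by [].
  by rewrite slice_chartK //; exact: QO.
- apply: continuous_in_subspaceT => x; rewrite inE => /WU.
  exact: slice_class_continuous_at.
- move=> _ [x Wx <-].
  by rewrite slice_chartK.
Qed.

(** The flow time of x drops by t along the flow at time t, and p only identifies
    points for which t is in 2 pi Z^m; so p is injective on a set where the flow
    times are at distance less than 1 from that of x0. *)
Lemma slice_domain_exists x0 : U x0 -> exists2 W, slice_domain W & W x0.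
Proof.
move=> x0U; pose tau := flow_time A K.
pose W : set 'rV[CC R]_v := [set x | U x /\ forall a, `|tau x0 ord0 a - tau x ord0 a| < 1].
exists W; last by split=> // a; rewrite subrr normr0.
split=> [|x []//|x x' [xU hx] [x'U hx'] /(slice_class_eq xU x'U)[t t1 x'E]].
  rewrite openE => x [xU hx].
  have h1 : \forall x' \near x, U x'.
    by apply: open_nbhs_nbhs; split=> //; exact: (open_arrangement_compl fanAK).
  have h2 : \forall x' \near x, forall a, `|tau x0 ord0 a - tau x' ord0 a| < 1.
    apply: (filter_forall (nbhs_filter x)) => a.
    have c : (fun x' => `|tau x0 ord0 a - tau x' ord0 a|) @ x -->
        `|tau x0 ord0 a - tau x ord0 a|.
      apply: (cvg_norm (F := nbhs x)); apply: (cvgB (F := nbhs x)).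
        exact: (@cvg_cst _ _ _ (nbhs x)).
      apply: (@cvg_coord R _ (nbhs x) _ 1 m tau (tau x) ord0 a).
      exact: (flow_time_continuous fanAK xU).
    exact: (cvgr_lt _ c).
  by apply: filterS2 h1 h2.
have t0 : t = 0.
  apply/rowP => a; rewrite mxE; apply: cexp_imaginary_eq1 (t1 a).
  have := hx' a; rewrite x'E /tau (flow_time_flow fanAK) // !mxE.
  have := hx a; rewrite /tau; set u := flow_time A K x0 ord0 a.
  set w := flow_time A K x ord0 a; rewrite !ltr_norml => /andP[? ?] /andP[? ?].
  by apply/andP; split; lra.
by rewrite x'E t0 flow0.
Qed.

Lemma slice_atlas_cover (q : N) : exists2 c, slice_atlas c & chart_dom c q.
Proof.
have [x xU <-] := slice_class_surj fanAK q.
have [W gW Wx] := slice_domain_exists xU.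
by exists (slice_chart W); [exists W|exists x].
Qed.

Lemma flow_differentiable t x : differentiable (@flow R v D A t) x.
Proof.
apply: differentiable_row => j.
have -> : (fun y => flow t y ord0 j) = cst ((expR ((t *m relations A) ord0 j))%:C%C : CC R) *
    (fun y : 'rV[CC R]_v => y ord0 j).
  by apply/funext => y; rewrite mxE.
by apply: differentiableM; [exact: differentiable_cst|exact: differentiable_coord].
Qed.

(** Near x1, changing from the chart W to the chart W' is the linear map [flow t]. *)
Lemma slice_transition W W' : slice_domain W -> slice_domain W' ->
  holomorphic_on (W `&` p @^-1` (p @` W')) (chart_map (slice_chart W') \o p).
Proof.
move=> [oW WU _] gW' x1 [Wx1 [x1' W'x1' e]]; have [oW' W'U _] := gW'.
have [t t1 x1'E] := slice_class_eq (WU _ Wx1) (W'U _ W'x1') (esym e).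
apply: (differentiable_near _ (flow_differentiable t x1)).
have h1 : \forall x \near x1, W x by exact: open_nbhs_nbhs.
have h2 : \forall x \near x1, W' (flow t x).
  have c : flow t x @[x --> x1] --> flow t x1 :=
    differentiable_continuous (flow_differentiable t x1).
  by rewrite -x1'E in c; apply: c; exact: open_nbhs_nbhs.
apply: filterS2 h1 h2 => x Wx W'x.
by rewrite /comp -(slice_class_flow fanAK (WU _ Wx) t1) slice_chartK.
Qed.

Lemma slice_atlas_complex : complex_atlas slice_atlas.
Proof.
split=> [_ [W gW ->]| |_ _ [W gW ->] [W' gW' ->]].
- exact: slice_chart_is_chart.
- exact: slice_atlas_cover.
- rewrite [X in holomorphic_on X](_ : _ = W `&` p @^-1` (p @` W')).
    exact: slice_transition.
  exact: slice_chart_image.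
Qed.

(** Read in a chart, the projection is the lift of [near_lift]. *)
Lemma orbit_proj_holomorphic :
  holomorphic_from_open slice_atlas (orbit_proj l : set_type S -> N).
Proof.
split; [exact: open_acceptable_points|exact: orbit_proj_continuous|].
move=> _ [W gW ->] z1 [x1 Wx1 e]; have [oW WU _] := gW.
have [X [_ dX hX]] := near_lift oW WU Wx1 e.
apply: differentiable_near dX; apply: filterS hX => z [Sz [WX pX]].
have -> : z = val (into base z) by rewrite intoK.
rewrite -[RHS]/(sigL S (valL_ 0 _) (into base z)).
rewrite (_ : sigL S _ = chart_map (slice_chart W) \o orbit_proj l); last first.
  exact: (congr1 (fun F => F _) (sigL_valL _)).
by rewrite intoK // /comp -pX slice_chartK.
Qed.

End Atlas.

(** * Second countability of the orbit space *)

Section RationalBoxes.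
Variables (R : realType) (n : nat).

Definition rational_point (a b : rat) : CC R := Complex (ratr a) (ratr b).

Definition rational_box (i : 'rV[rat]_n * 'rV[rat]_n * nat) : set 'rV[CC R]_n :=
  [set x | forall j, cmod (x ord0 j - rational_point (i.1.1 ord0 j) (i.1.2 ord0 j))
    < i.2.+1%:R^-1].

Lemma cmodN (z : CC R) : cmod (- z) = cmod z.
Proof. by apply: (@complexI R); rewrite -!cmodE normrN. Qed.

Lemma cmodD (z w : CC R) : cmod (z + w) <= cmod z + cmod w.
Proof. by rewrite -lecR rmorphD /= -!cmodE ler_normD. Qed.

Lemma open_rational_box i : open (rational_box i).
Proof.
rewrite openE => x hx; apply: (filter_forall (nbhs_filter x)) => j.
set c := rational_point _ _.
have h : (fun y : 'rV[CC R]_n => cmod (y ord0 j - c)) @ x --> cmod (x ord0 j - c).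
  have hj : (fun y : 'rV[CC R]_n => y ord0 j - c) @ x --> x ord0 j - c.
    exact: (cvgB (@coord_continuous (CC R) _ _ ord0 j x) (@cvg_cst _ c _ (nbhs x) _)).
  exact: (cvg_comp _ _ hj (@cmod_continuous R _)).
exact: (cvgr_lt _ h _ (hx j)).
Qed.

Lemma rational_box_basis (x : 'rV[CC R]_n) (P : set 'rV[CC R]_n) :
  nbhs x P -> exists2 i, rational_box i x & rational_box i `<=` P.
Proof.
move=> xP.
have [e e0 eP] : exists2 e : R, 0 < e &
    forall y : 'rV[CC R]_n, (forall j, cmod (x ord0 j - y ord0 j) < e) -> P y.
  move/nbhs_ballP: xP => [_ /pos_complex[e e0 ->] eP]; exists e => // y hy.
  by apply: eP; split; [rewrite ltcR|move=> i j; rewrite -ball_normE /= ord1 normc_lt].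
have [k ke] : exists k, (k.+1%:R : R)^-1 < e / 2.
  have e2 : 0 < e / 2 by rewrite divr_gt0.
  exists (Num.truncn (e / 2)^-1); rewrite invf_plt ?posrE ?ltr0n //.
  by rewrite truncnS_gt.
have dens (r : R) : exists q : rat, `|r - ratr q| < k.+1%:R^-1 / 2.
  have : 0 < (k.+1%:R : R)^-1 / 2 by rewrite divr_gt0 // invr_gt0 ltr0n.
  move: (_ / 2) => s s0; have rs : r - s < r + s by lra.
  have [q] := rat_in_itvoo rs.
  by rewrite in_itv /= => /andP[h1 h2]; exists q; rewrite ltr_norml; apply/andP; split; lra.
pose re : 'rV[rat]_n := \row_j xget 0
  [set q : rat | `|complex.Re (x ord0 j) - ratr q| < k.+1%:R^-1 / 2].
pose im : 'rV[rat]_n := \row_j xget 0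
  [set q : rat | `|complex.Im (x ord0 j) - ratr q| < k.+1%:R^-1 / 2].
have xbox : rational_box (re, im, k) x.
  move=> j /=; apply: le_lt_trans (cmod_le _) _; rewrite [ltRHS]splitr.
  have h1 := xgetPex 0 (dens (complex.Re (x ord0 j))).
  have h2 := xgetPex 0 (dens (complex.Im (x ord0 j))).
  by rewrite !mxE; case: (x ord0 j) h1 h2 => a b /= h1 h2; exact: ltrD.
exists (re, im, k) => // y hy; apply: eP => j.
have := xbox j; have := hy j; rewrite /=; set c := rational_point _ _ => h1 h2.
have -> : x ord0 j - y ord0 j = (x ord0 j - c) + - (y ord0 j - c) by ring.
apply: le_lt_trans (cmodD _ _) _; rewrite cmodN [e]splitr.
by apply: ltrD; [exact: lt_trans h2 ke|exact: lt_trans h1 ke].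
Qed.

End RationalBoxes.

Section OrbitManifold.
Variables (R : realType) (v D : nat) (A : 'M[R]_(v, D)) (K : {set {set 'I_v}}).
Hypothesis fanAK : complete_fan A K.
Notation l := (@lvmb_family R v D A).
Notation E := (lvmb_sets A K).
Notation N := (orbit_space E l).
Notation U := (@arrangement_compl R v K).
Notation p := (slice_class fanAK).

(** The quotient map p is open and onto, so the images of the rational boxes form a
    basis. *)
Lemma orbit_space_second_countable : @second_countable N.
Proof.
exists (range (fun i => p @` (@rational_box R v i `&` U))).
  exact: (sub_countable (card_image_le _ _)).
have oU : open U := open_arrangement_compl fanAK.
split=> [_ [i _ <-]|q O qO].
  apply: slice_class_open; last by move=> x [].
  by apply: openI => //; exact: open_rational_box.
have [x xU xq] := slice_class_surj fanAK q; rewrite -xq in qO *.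
have pc : p y @[y --> x] --> p x := slice_class_continuous_at xU.
have xO : \forall y \near x, O (p y) by exact: pc qO.
have [i ix iO] := rational_box_basis xO.
exists (p @` (rational_box i `&` U)); first by split; [exists i|exists x].
by move=> _ [y [yi _] <-]; exact: iO.
Qed.

Lemma slice_atlas_structure : lvmb_structure (slice_atlas fanAK).
Proof.
split; last exact: orbit_proj_holomorphic.
split; [exact: orbit_space_hausdorff|exact: orbit_space_second_countable|
  exact: orbit_space_compact|exact: slice_atlas_complex].
Qed.

Lemma lvmb_good : good_system E l.
Proof.
split; first exact: lvmb_acceptable.
by exists v, (slice_atlas fanAK); exact: slice_atlas_structure.
Qed.

End OrbitManifold.

(** * Transport of a complex structure along a homeomorphism *)

Section Transport.
Variables (R : realType) (T X : topologicalType) (k : nat).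
Variables (h : T -> X) (g : X -> T).
Hypotheses (hc : continuous h) (gc : continuous g) (hK : cancel h g) (gK : cancel g h).

Definition pull_chart (c : chart R X k) : chart R T k :=
  Chart (h @^-1` chart_dom c) (chart_map c \o h) (g \o chart_inv c).

Definition pull_atlas (A : set (chart R X k)) : set (chart R T k) := pull_chart @` A.

Lemma pull_image (c : chart R X k) (Q : set X) :
  (chart_map c \o h) @` (h @^-1` (chart_dom c `&` Q)) =
  chart_map c @` (chart_dom c `&` Q).
Proof.
apply/seteqP; split=> [_ [x hx <-]|_ [x hx <-]]; first by exists (h x).
by exists (g x); rewrite /= gK.
Qed.

Lemma pull_is_chart (c : chart R X k) : is_chart c -> is_chart (pull_chart c).
Proof.
move=> [d1 d2 c1 c2 cK].
have img : (chart_map c \o h) @` (h @^-1` chart_dom c) = chart_map c @` chart_dom c.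
  by have := pull_image c setT; rewrite !setIT.
split; rewrite /= ?img //.
- by apply: open_comp => // x _; exact: hc.
- apply/subspace_continuousP => x hx.
  have c1' := (iffLR (subspace_continuousP _ _)) c1 (h x) hx.
  apply: cvg_trans c1'; apply: cvg_trans (cvg_app _ _); last exact: cvg_id.
  move=> Q hQ; exact: (hc hQ).
- move=> x; apply: continuous_comp; first exact: c2.
  exact: gc.
- by move=> x hx /=; rewrite cK ?hK.
Qed.

Lemma pull_manifold (A : set (chart R X k)) :
  compact_complex_manifold A -> compact_complex_manifold (pull_atlas A).
Proof.
move=> [hX [Bs cB [Bo bB]] kX [ch cov tr]]; split.
- exact: hausdorff_inj hc (can_inj hK) hX.
- exists ((fun Q => h @^-1` Q) @` Bs); first exact: (sub_countable (card_image_le _ _)).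
  split=> [_ [Q BQ <-]|x O xO].
    by apply: open_comp => [y _|]; [exact: hc|exact: Bo].
  have gO : nbhs (h x) (g @^-1` O) by apply: gc; rewrite hK.
  have [Q [BQ Qx] QO] := bB (h x) _ gO.
  exists (h @^-1` Q); first by split=> //; exists Q.
  by move=> y Qy; have := QO _ Qy; rewrite /= hK.
- rewrite (_ : [set: T] = g @` [set: X]).
    by apply: continuous_compact => //; exact: continuous_subspaceT.
  by apply/seteqP; split=> // x _; exists (h x).
- split=> [_ [c Ac <-]|x|_ _ [c Ac <-] [c' Ac' <-]].
  + exact/pull_is_chart/ch.
  + by have [c Ac cx] := cov (h x); exists (pull_chart c) => //; exists c.
  + have := tr c c' Ac Ac'; rewrite /= -preimage_setI pull_image.
    by congr (holomorphic_on _ _); apply/funext => y /=; rewrite gK.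
Qed.

Lemma pull_biholomorphic (A : set (chart R X k)) :
  compact_complex_manifold A -> biholomorphic (pull_atlas A) A.
Proof.
move=> [_ _ _ [_ _ tr]]; exists h, g; split=> //; split=> //.
  move=> _ c' [c Ac <-] Ac'; have := tr c c' Ac Ac'.
  rewrite /= -preimage_setI pull_image.
  by congr (holomorphic_on _ _); apply/funext => y /=; rewrite gK.
move=> c _ Ac [c' Ac' <-]; have := tr c c' Ac Ac'; rewrite /=.
congr (holomorphic_on _ _); last by apply/funext => y /=; rewrite gK.
congr (_ @` (_ `&` _)); apply/funext => y /=; by rewrite gK.
Qed.

End Transport.

(** * Moment-angle complexes as LVMB manifolds *)

Lemma moment_angle_prod_homeo (R : realType) (v q : nat) (K : {set {set 'I_v}}) :
  exists h : (set_type (moment_angle R K) * set_type (torus R q))%type ->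
             set_type (moment_angle R (extend_complex q K)),
    homeomorphism h /\ forall z w, val (h (z, w)) = row_mx (val z) (val w).
Proof.
have inZ (p : set_type (moment_angle R K) * set_type (torus R q)) :
    moment_angle R (extend_complex q K) (row_mx (val p.1) (val p.2)).
  by apply/moment_angle_row_mx; split; exact: set_valP.
have sub (u : set_type (moment_angle R (extend_complex q K))) :
    moment_angle R K (lsubmx (val u)) /\ torus R q (rsubmx (val u)).
  by apply/moment_angle_row_mx; rewrite hsubmxK; exact: set_valP.
pose h p : set_type (moment_angle R (extend_complex q K)) :=
  exist (fun u => u \in moment_angle R (extend_complex q K)) _ (mem_set (inZ p)).
pose g1 u : set_type (moment_angle R K) :=
  exist (fun u => u \in moment_angle R K) _ (mem_set (sub u).1).
pose g2 u : set_type (torus R q) :=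
  exist (fun u => u \in torus R q) _ (mem_set (sub u).2).
have g1c : continuous g1.
  apply: set_type_continuous => u; apply: (cvg_mx (F := nbhs u)) => i j.
  rewrite /= mxE; under eq_fun do rewrite /= mxE.
  apply: (@cvg_coord (CC R) _ (nbhs u) _ 1 (v + q) val (val u) i (lshift q j)).
  exact: val_continuous.
have g2c : continuous g2.
  apply: set_type_continuous => u; apply: (cvg_mx (F := nbhs u)) => i j.
  rewrite /= mxE; under eq_fun do rewrite /= mxE.
  apply: (@cvg_coord (CC R) _ (nbhs u) _ 1 (v + q) val (val u) i (rshift v j)).
  exact: val_continuous.
exists h; split=> //; exists (fun u => (g1 u, g2 u)); split.
- have c1 : continuous
      (fun p : set_type (moment_angle R K) * set_type (torus R q) => val p.1).
    move=> p O hO.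
    exact: (@cvg_fst _ _ (nbhs p.1) (nbhs p.2) _ _ (@val_continuous _ _ p.1 _ hO)).
  have c2 : continuous
      (fun p : set_type (moment_angle R K) * set_type (torus R q) => val p.2).
    move=> p O hO.
    exact: (@cvg_snd _ _ (nbhs p.1) (nbhs p.2) _ _ (@val_continuous _ _ p.2 _ hO)).
  apply: set_type_continuous => p; apply: (cvg_mx (F := nbhs p)) => i k; rewrite ord1.
  case: (split_ordP k) => j ->.
    rewrite /= row_mxEl; under eq_fun do rewrite /= row_mxEl.
    apply: (@cvg_coord (CC R) _ (nbhs p) _ 1 v (fun p => val p.1) (val p.1) ord0 j).
    exact: c1.
  rewrite /= row_mxEr; under eq_fun do rewrite /= row_mxEr.
  apply: (@cvg_coord (CC R) _ (nbhs p) _ 1 q (fun p => val p.2) (val p.2) ord0 j).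
  exact: c2.
- by move=> u; exact: (cvg_pair (g1c u) (g2c u)).
- move=> [z w]; congr pair; apply: val_inj; rewrite /= ?row_mxKl ?row_mxKr //.
- by move=> u; apply: val_inj; rewrite /= hsubmxK.
Qed.

Theorem theorem2 (R : realType) (v d : nat) (K : {set {set 'I_v}})
    (vertexK : has_full_vertex_set K)
    (starK : rationally_starshaped_sphere R d K) :
  exists q : nat,
    (exists h : (set_type (moment_angle R K) * set_type (torus R q))%type ->
                set_type (moment_angle R (extend_complex q K)),
       homeomorphism h /\
       forall z w, val (h (z, w)) = row_mx (val z) (val w)) /\
    exists (m n : nat) (E : {set {set 'I_n}}) (l : 'I_n -> 'rV[CC R]_m),
      [/\ good_system E l,
          homeomorphic (set_type (moment_angle R (extend_complex q K)))
                       (orbit_space E l)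
        & exists (k : nat) (A : set (chart R (orbit_space E l) k))
            (B : set (chart R (set_type (moment_angle R (extend_complex q K))) k)),
            [/\ lvmb_structure A, compact_complex_manifold B
              & biholomorphic B A]].
Proof.
have [A fanAK] := rationally_starshaped_fan vertexK starK.
exists (\rank (kermx A)); split; first exact: moment_angle_prod_homeo.
exists (\rank (kermx A)), (1 + (v + \rank (kermx A)))%N, (lvmb_sets A K),
  (@lvmb_family R v d.+1 A).
have hc : continuous (moment_angle_class fanAK) by exact: moment_angle_class_continuous.
have gc : continuous (class_moment_angle fanAK) by exact: class_moment_angle_continuous.
have hK := @moment_angle_classK _ _ _ _ _ fanAK.
have gK := @class_moment_angleK _ _ _ _ _ fanAK.
have [sA hA] := slice_atlas_structure fanAK.
split; first exact: lvmb_good.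
  by exists (moment_angle_class fanAK), (class_moment_angle fanAK).
exists v, (slice_atlas fanAK),
  (pull_atlas (moment_angle_class fanAK) (class_moment_angle fanAK) (slice_atlas fanAK)).
split=> //; first exact: pull_manifold.
exact: pull_biholomorphic.
Qed.
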